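(* Let $K$ be an algebraically closed field and let $n, d \geq 1$ be integers. For each $f = [F] = [F_0 : \ldots : F_n] \in \mathrm{End}_{d/K}^n$, the following are equivalent: \begin{enumerate} \item the map $f$ is inseparable; \item $J^*_F = 0$; \item $C_f = \mathbb{P}^n$. \end{enumerate}
   Context: $\mathrm{End}_{d/K}^n$ is the set of classes $[F]=[F_0:\ldots:F_n]$ (up to simultaneous nonzero scaling) of tuples of homogeneous forms of degree $d$ in $K[x_0,\ldots,x_n]$ with no common zero in $\mathbb{P}^n(K)$, identified with the endomorphism $f: x\mapsto[F_0(x):\ldots:F_n(x)]$ of $\mathbb{P}^n_K$. A generically finite morphism of integral schemes is (generically) separable if it is dominant and the induced extension of function fields is separable; $f$ is inseparable if it is not separable. Flat Jacobian: let $F_i^{\mathrm{univ}} := \sum_{|\alpha|=d} u_{i,\alpha}x^\alpha \in \mathbb{Z}[\mathbf u][\mathbf x]$ ($0\le i\le n$) be the universal tuple, with indeterminates $u_{i,\alpha}$ indexed by $0\le i\le n$ and multi-indices $\alpha\in\mathbb{N}^{n+1}$ with $|\alpha|=d$. Let $J_{n,d} := \det\left(\partial F_i^{\mathrm{univ}}/\partial x_j\right)_{0\le i,j\le n}\in\mathbb{Z}[\mathbf u][\mathbf x]$. It is a fact that $d$ divides $J_{n,d}$ in $\mathbb{Z}[\mathbf u][\mathbf x]$; the generic flat Jacobian is $J^*_{n,d} := \frac1d J_{n,d}$. For a tuple $F$ of forms of degree $d$ over $K$, $J^*_F := \theta_F(J^*_{n,d})\in K[\mathbf x]$, where $\theta_F:\mathbb{Z}[\mathbf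 u][\mathbf x]\to K[\mathbf x]$ is the ring homomorphism fixing each $x_j$ and sending $u_{i,\alpha}$ to the coefficient of $x^\alpha$ in $F_i$. Critical scheme: let $f: X \to Y$ be a morphism of nonsingular varieties over $K$ of the same dimension $r$. It induces a homomorphism of vector bundles $f^*(T^*Y)\to T^*X$ and, dually, the differential $f': TX \to f^*(TY)$, a homomorphism of rank-$r$ vector bundles on $X$. The critical scheme $C_f$ is the zero scheme of $\det f'$: the closed subscheme of $X$ which on each open set trivializing both bundles is defined by the determinant of a matrix representing $f'$. *)

(* Defs.v *)
From HB Require Import structures.
From mathcomp Require Import all_boot all_order all_algebra all_field.
From mathcomp.multinomials Require Export mpoly.

Set Implicit Arguments.
Unset Strict Implicit.
Unset Printing Implicit Defensive.

Import GRing.Theory.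
Local Open Scope ring_scope.

(** * The flat Jacobian *)

Definition mindex (n d : nat) := {a : 'X_{1..n.+1 < d.+1} | mdeg a == d}.

Definition mindex_mnm n d (a : mindex n d) : 'X_{1..n.+1} := bmnm (val a).

(* Index set of the indeterminates u_(i, a); the ring Z[u] is
   {mpoly int[nuniv n d]}, the variable u_(i, a) being 'X_(enum_rank (i, a)). *)
Definition uindex (n d : nat) : finType := ('I_n.+1 * mindex n d)%type.

Definition nuniv (n d : nat) : nat := #|uindex n d|.

Definition univ_coef n d (i : 'I_n.+1) (a : mindex n d) : {mpoly int[nuniv n d]} :=
  'X_(enum_rank ((i, a) : uindex n d)).

Definition univ_form n d (i : 'I_n.+1) : {mpoly {mpoly int[nuniv n d]}[n.+1]} :=
  \sum_(a : mindex n d) univ_coef i a *: 'X_[mindex_mnm a].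

Definition univ_jacobian_mx n d : 'M[{mpoly {mpoly int[nuniv n d]}[n.+1]}]_n.+1 :=
  \matrix_(i, j) mderiv j (univ_form d i).

Definition univ_jacobian n d : {mpoly {mpoly int[nuniv n d]}[n.+1]} :=
  \det (univ_jacobian_mx n d).

(* Division of every integer coefficient by d; it is exact on univ_jacobian,
   see univ_flat_jacobianE. *)
Definition coef_div N (d : nat) (p : {mpoly int[N]}) : {mpoly int[N]} :=
  \sum_(k <- msupp p) (p@_k %/ d%:Z)%Z *: 'X_[k].

Definition univ_flat_jacobian n d : {mpoly {mpoly int[nuniv n d]}[n.+1]} :=
  \sum_(m <- msupp (univ_jacobian n d))
     coef_div d (univ_jacobian n d)@_m *: 'X_[m].

Lemma mcoeff_sum_msupp (R : nzRingType) N (g : R -> R) (p : {mpoly R[N]}) m :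
  g 0 = 0 -> (\sum_(k <- msupp p) g p@_k *: 'X_[k])@_m = g p@_m.
Proof.
move=> g0; rewrite raddf_sum /=.
under eq_bigr do rewrite mcoeffZ mcoeffX.
have [mp|mNp] := boolP (m \in msupp p).
  rewrite (bigD1_seq m) ?msupp_uniq //= eqxx mulr1 big1 ?addr0 // => k kNm.
  by rewrite (negPf kNm) mulr0.
rewrite (memN_msupp_eq0 mNp) g0 big_seq big1 // => k kp.
by case: eqP => [km|_]; rewrite ?mulr0 //; rewrite -km kp in mNp.
Qed.

Lemma euler_univ_form n d (i : 'I_n.+1) :
  \sum_j mderiv j (univ_form d i) * 'X_j = d%:R * univ_form d i.
Proof.
under eq_bigr => j _ do rewrite /univ_form raddf_sum mulr_suml.
rewrite exchange_big /= /univ_form mulr_sumr; apply: eq_bigr => a _.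
under eq_bigr => j _ do rewrite /= mderivZ mderivX -!scalerAl -mpolyXD.
rewrite -scaler_sumr -scalerAr; congr (_ *: _).
have dE : mdeg (mindex_mnm a) = d := eqP (valP a).
transitivity ((mdeg (mindex_mnm a))%:R * 'X_[mindex_mnm a] :
  {mpoly {mpoly int[nuniv n d]}[n.+1]}); last by rewrite dE.
rewrite mdegE natr_sum mulr_suml; apply: eq_bigr => j _.
case E: (mindex_mnm a j) => [|k]; first by rewrite scale0r mul0r.
rewrite submK; first by rewrite -mul_mpolyC mpolyC_nat.
by apply/mnm_lepP => l; rewrite mnm1E; case: eqP => // <-; rewrite E.
Qed.

Lemma univ_flat_jacobianE n d : (0 < d)%N ->
  d%:R * univ_flat_jacobian n d = univ_jacobian n d.
Proof.
move=> d_gt0; set J := univ_jacobian n d.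
pose M := univ_jacobian_mx n d.
pose X := \col_(j < n.+1) 'X_j : 'cV[{mpoly {mpoly int[nuniv n d]}[n.+1]}]_n.+1.
pose G := \col_(i < n.+1) univ_form d i.
have MX : M *m X = d%:R *: G.
  apply/matrixP => i j; rewrite !mxE -euler_univ_form.
  by apply: eq_bigr => k _; rewrite !mxE.
have [Q JQ] : exists Q, J * 'X_ord0 = d%:R * Q.
  exists ((\adj M *m G) ord0 0).
  have adjMX : \det M *: X = d%:R *: (\adj M *m G).
    by rewrite -mul_scalar_mx -mul_adj_mx -mulmxA MX scalemxAr.
  have := congr1 (fun Z : 'cV_n.+1 => Z ord0 0) adjMX.
  by rewrite [LHS]mxE [RHS]mxE [X ord0 0]mxE.
have Jm m : J@_m = d%:R * Q@_(m + U_(ord0)).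
  by rewrite -[LHS](@mcoeffMX _ _ J U_(ord0)%MM) JQ addmC -mpolyC_nat mcoeffCM.
apply/mpolyP => m; rewrite -mpolyC_nat mcoeffCM mcoeff_sum_msupp; last first.
  by rewrite /coef_div msupp0 big_nil.
apply/mpolyP => k; rewrite -mpolyC_nat mcoeffCM.
rewrite (@mcoeff_sum_msupp _ _ (fun c => (c %/ d%:Z)%Z)) ?div0z //.
rewrite Jm -mpolyC_nat mcoeffCM natz mulKz //.
by rewrite eqz_nat -lt0n.
Qed.

Definition specialize_coef (K : fieldType) n d (F : (n.+1).-tuple {mpoly K[n.+1]})
    (k : 'I_(nuniv n d)) : K :=
  let: (i, a) := (enum_val k : uindex n d) in (tnth F i)@_(mindex_mnm a).

Definition theta (K : fieldType) n d (F : (n.+1).-tuple {mpoly K[n.+1]}) :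
    {mpoly {mpoly int[nuniv n d]}[n.+1]} -> {mpoly K[n.+1]} :=
  map_mpoly (mmap (intr : int -> K) (specialize_coef F)).

Definition flat_jacobian (K : fieldType) n d (F : (n.+1).-tuple {mpoly K[n.+1]}) :
    {mpoly K[n.+1]} :=
  theta F (univ_flat_jacobian n d).

(** * Projective space and its endomorphisms *)

Section ProjectiveSpace.

Variables (K : closedFieldType) (n : nat).

Notation poly := {mpoly K[n.+1]}.

(* K(x_0, ..., x_n); the function field and the local rings of P^n are the
   subsets of it consisting of suitable homogeneous fractions of degree 0. *)
Notation ratfun := {fraction {mpoly K[n.+1]}}.

Notation "p %:F" := (@tofrac _ p).

(* A point of P^n(K) is represented by a nonzero vector of homogeneous
   coordinates.  Since K is algebraically closed, the closed points of P^n
   are its K-points. *)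
Notation coords := 'rV[K]_n.+1.

(* F represents an element of End_d^n. *)
Definition is_endomorphism (d : nat) (F : (n.+1).-tuple poly) : Prop :=
  (forall i, tnth F i \is d.-homog) /\
  (forall x : coords, x != 0 -> exists i, (tnth F i).@[x 0] != 0).

Definition map_point (F : (n.+1).-tuple poly) (x : coords) : coords :=
  \row_i (tnth F i).@[x 0].

Definition zariski_open (U : coords -> Prop) : Prop :=
  exists S : poly -> Prop,
    (forall g, S g -> exists m, g \is m.-homog) /\
    (forall x, U x <-> x != 0 /\ exists2 g, S g & g.@[x 0] != 0).

Definition function_field (s : ratfun) : Prop :=
  exists m (g h : poly),
    [/\ g \is m.-homog, h \is m.-homog, h != 0 & s = g%:F / h%:F].

Definition local_ring (x : coords) (s : ratfun) : Prop :=
  exists m (g h : poly),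
    [/\ g \is m.-homog, h \is m.-homog, h.@[x 0] != 0 & s = g%:F / h%:F].

(* t is the pullback of the rational function s along f = [F]. *)
Definition pullback (F : (n.+1).-tuple poly) (s t : ratfun) : Prop :=
  exists m (g h : poly),
    [/\ g \is m.-homog, h \is m.-homog, h \mPo F != 0,
        s = g%:F / h%:F & t = (g \mPo F)%:F / (h \mPo F)%:F].

(** * Separability *)

Definition dominant (F : (n.+1).-tuple poly) : Prop :=
  forall U, zariski_open U -> (exists y, U y) ->
    exists2 x, x != 0 & U (map_point F x).

Definition coefs_in (k : ratfun -> Prop) (p : {poly ratfun}) : Prop :=
  forall i, k p`_i.

Definition is_min_poly (k : ratfun -> Prop) (a : ratfun) (p : {poly ratfun}) : Prop :=
  [/\ p \is monic, coefs_in k p, root p a &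
      forall q, q != 0 -> coefs_in k q -> root q a -> (size p <= size q)%N].

(* The algebraic extension E / k of subfields of ratfun is separable. *)
Definition separable_extension (k E : ratfun -> Prop) : Prop :=
  forall a, E a -> exists2 p, is_min_poly k a p & separable_poly p.

(* The induced extension of function fields is K(P^n) / f^* K(P^n); it is
   finite as soon as f is dominant. *)
Definition separable_map (F : (n.+1).-tuple poly) : Prop :=
  dominant F /\
  separable_extension (fun t => exists s, pullback F s t) function_field.

Definition inseparable_map (F : (n.+1).-tuple poly) : Prop := ~ separable_map F.

(** * The critical scheme *)

(* K-derivations from the K-algebra A to the K-algebra B, the latter being an
   A-module via the ring morphism A -> B whose graph is phi.  Only the values
   of the derivation D on A are meaningful. *)
Definition derivation (A B : ratfun -> Prop) (phi : ratfun -> ratfun -> Prop)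
    (D : ratfun -> ratfun) : Prop :=
  [/\ forall s, A s -> B (D s),
      forall s t, A s -> A t -> D (s + t) = D s + D t,
      forall (c : K) s, A s -> D (c%:MP%:F * s) = c%:MP%:F * D s &
      forall s t s' t', A s -> A t -> phi s s' -> phi t t' ->
        D (s * t) = s' * D t + t' * D s].

(* D_0, ..., D_(n-1) is a basis of the B-module of these derivations. *)
Definition derivation_basis (A B : ratfun -> Prop) (phi : ratfun -> ratfun -> Prop)
    (D : 'I_n -> ratfun -> ratfun) : Prop :=
  (forall k, derivation A B phi (D k)) /\
  (forall T, derivation A B phi T ->
     exists! a : 'rV[ratfun]_n,
       (forall k, B (a 0 k)) /\
       (forall s, A s -> T s = \sum_k a 0 k * D k s)).

(* The stalk at x of the tangent bundle TX is Der_K(O_x, O_x). *)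
Definition tangent_basis (x : coords) :=
  derivation_basis (local_ring x) (local_ring x) eq.

(* The stalk at x of f^*(TY) = Hom(f^*(T^*Y), O_X) is Der_K(O_f(x), O_x). *)
Definition pullback_tangent_basis (F : (n.+1).-tuple poly) (x : coords) :=
  derivation_basis (local_ring (map_point F x)) (local_ring x) (pullback F).

(* A is the matrix of the differential f' : TX -> f^*(TY), which maps a
   derivation D of O_x to its composite with the comorphism O_f(x) -> O_x. *)
Definition differential_matrix (F : (n.+1).-tuple poly) (x : coords)
    (D E : 'I_n -> ratfun -> ratfun) (A : 'M[ratfun]_n) : Prop :=
  (forall k l, local_ring x (A k l)) /\
  (forall k s t, local_ring (map_point F x) s -> pullback F s t ->
     D k t = \sum_l A k l * E l s).

(* A closed subscheme of the integral scheme P^n is given by its sheaf of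
   ideals, here U |-> I(U), a subset of the function field, for U a nonempty
   open set. *)
Definition closed_subscheme := (coords -> Prop) -> ratfun -> Prop.

Definition eq_subscheme (I J : closed_subscheme) : Prop :=
  forall U, zariski_open U -> (exists x, U x) -> forall s, I U s <-> J U s.

Definition projective_space : closed_subscheme := fun _ s => s = 0.

(* The ideal of O_x generated by det f', computed in local trivializations. *)
Definition critical_ideal (F : (n.+1).-tuple poly) (x : coords) (s : ratfun) : Prop :=
  exists D E A, [/\ tangent_basis x D, pullback_tangent_basis F x E,
    differential_matrix F x D E A &
    exists2 a, local_ring x a & s = a * \det A].

Definition critical_scheme (F : (n.+1).-tuple poly) : closed_subscheme :=
  fun U s => forall x, U x -> critical_ideal F x s.

End ProjectiveSpace.

Arguments projective_space {K n}.

(* Main.v *)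
(* With M_i the Jacobian matrix whose i-th column is replaced by F, Euler's
   identity, universally and after division by d, gives x_i J*_F = det M_i.  Where
   x_i and F_j do not vanish, an elementary row operation turns det M_i into a unit
   times the determinant of d(F_l/F_j)/d(x_k/x_i), so J*_F vanishes iff this chart
   Jacobian is singular.  The chart Jacobian is the matrix of the differential in
   the standard bases of the stalks, whence (2) <-> (3).

   If it is singular, a vector in its kernel is a nonzero derivation of K(P^n)
   killing f^* K(P^n), which no separable extension allows.  If it is invertible,
   take a relation Q(F_l/F_j, a) = 0 (one exists by counting forms) with a partial
   derivative not vanishing there, as K is perfect; by the chain rule the derivative
   with respect to the last variable cannot vanish, so a is separable over
   f^* K(P^n).  The same argument without a shows that f is dominant. *)
Require Import Defs.
From mathcomp Require Import all_boot all_order all_algebra all_field.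
From mathcomp Require Import ring.
From Stdlib Require Import Classical ClassicalEpsilon.

Set Implicit Arguments.
Unset Strict Implicit.
Unset Printing Implicit Defensive.

Import GRing.Theory.
Local Open Scope ring_scope.

Local Notation "p %:F" := (@tofrac _ p) : ring_scope.

(** * Polynomials over an algebraically closed field *)

Lemma mpoly_ring_ind (R : nzRingType) N (P : {mpoly R[N]} -> Prop) :
  (forall c, P c%:MP) -> (forall i, P 'X_i) ->
  (forall p q, P p -> P q -> P (p + q)) ->
  (forall p q, P p -> P q -> P (p * q)) -> forall p, P p.
Proof.
move=> PC PX PD PM; elim/mpolyind => [|c m p _ _ Pp]; first by rewrite -mpolyC0.
apply: PD => //; rewrite -mul_mpolyC; apply: (PM) => //.
rewrite mpolyXE_id; apply: (big_ind P) => //.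
  by rewrite -mpolyC1.
move=> i _; elim: (m i) => [|k IH]; first by rewrite expr0 -mpolyC1.
by rewrite exprS; apply: PM.
Qed.

Lemma closed_poly_eq0 (K : closedFieldType) (p : {poly K}) :
  (forall x, p.[x] = 0) -> p = 0.
Proof.
move=> p0; apply/eqP; apply: contraT => /closed_nonrootP [x].
by rewrite rootE p0 eqxx.
Qed.

(** Induction on the number of variables: [muni] reads [p] as a polynomial in its last variable,
    whose coefficients vanish at every point because a polynomial in one variable over an infinite
    field has no room for infinitely many roots. *)
Lemma mpoly_eq0_eval (K : closedFieldType) N (p : {mpoly K[N]}) :
  (forall x : 'I_N -> K, p.@[x] = 0) -> p = 0.
Proof.
elim: N p => [|N IH] p p0.
  have pE := nvar0_mpolyC p; rewrite pE in p0 *.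
  by have := p0 (fun=> 0); rewrite mevalC => ->.
have widenE (i : 'I_N) : widen_ord (leqnSn N) i = lift ord_max i.
  by apply/val_inj; rewrite [RHS]lift_max.
pose ext (x : 'I_N -> K) t (i : 'I_N.+1) := if unlift ord_max i is Some j then x j else t.
have evalE x t : p.@[ext x t] = (map_poly (meval x) (muni p)).[t].
  rewrite mevalE muniE rmorph_sum /= horner_sum; apply: eq_bigr => m _.
  rewrite linearZ /= map_polyXn hornerZ hornerXn mevalZ mevalX -mulrA.
  rewrite big_ord_recr /= /ext unlift_none; congr (_ * (_ * _)).
  by apply: eq_bigr => i _; rewrite mnmE widenE liftK.
have muni0 : muni p = 0.
  apply/polyP => k; rewrite coef0; apply: IH => x.
  have /(congr1 (fun q : {poly K} => q`_k)) : map_poly (meval x) (muni p) = 0.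
    by apply: closed_poly_eq0 => t; rewrite -evalE.
  by rewrite coef0 coef_map.
(* [muni] loses nothing: the coefficient of [p] at [m] is found in degree [m ord_max], at the
   truncation of [m] to the first [N] variables. *)
apply/mpolyP => m; rewrite mcoeff0.
have := congr1 (fun q : {poly {mpoly K[N]}} =>
  q`_(m ord_max)@_[multinom m (widen_ord (leqnSn N) i) | i < N]) muni0.
rewrite muniE coef_sum raddf_sum coef0 mcoeff0 /= => <-.
rewrite [in LHS](mpolyE p) raddf_sum /=; apply: eq_bigr => k _.
rewrite mcoeffZ mcoeffX coefZ coefXn mulr_natr mcoeffMn mcoeffZ mcoeffX -mulrnAr -mulrnA mulnb.
congr (_ * (nat_of_bool _)%:R).
apply/eqP/andP => [->|[/eqP/mnmP Ek /eqP Emax]]; first by rewrite !eqxx.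
apply/mnmP => i; case: (unliftP ord_max i) => [j|] ->; last by rewrite Emax.
by have := Ek j; rewrite !mnmE widenE.
Qed.

Lemma msize_exp (R : idomainType) N (p : {mpoly R[N]}) k :
  p != 0 -> msize (p ^+ k) = ((msize p).-1 * k).+1.
Proof.
move=> nzp; elim: k => [|k IH]; first by rewrite expr0 msize1 muln0.
rewrite exprS msizeM ?expf_neq0 // IH addnS /= mulnS -addSn prednK //.
by rewrite lt0n msize_poly_eq0.
Qed.

(** Vanishing derivatives force [p] to divide every exponent in the support. The coefficients have
    [p]-th roots in [K], and Frobenius is additive, so the root is taken term by term. *)
Lemma mpoly_pth_root (K : closedFieldType) N p (P : {mpoly K[N]}) :
  p \in [pchar K] -> (forall i, P^`M(i) = 0) -> exists Q, P = Q ^+ p.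
Proof.
move=> chp dP0; have p_pr := pcharf_prime chp; have p_gt0 := prime_gt0 p_pr.
have chP : p \in [pchar {mpoly K[N]}] by apply: (rmorph_pchar (@mpolyC N K)).
have rootK (c : K) : exists x, x ^+ p == c.
  have /closed_rootP [x] : size ('X^p - c%:P) != 1%N by rewrite size_XnsubC // eqSS -lt0n.
  by rewrite rootE !hornerE subr_eq0; exists x.
pose r c := xchoose (rootK c).
have rK c : r c ^+ p = c by apply/eqP/(xchooseP (rootK c)).
exists (\sum_(m <- msupp P) r P@_m *: 'X_[[multinom (m i %/ p)%N | i < N]]).
rewrite -(pFrobenius_autE chP) rmorph_sum {1}(mpolyE P) /=.
rewrite !big_seq; apply: eq_bigr => m mP.
rewrite pFrobenius_autE exprZn rK; congr (_ *: _).
rewrite mpolyXn; congr 'X_[_]; apply/mnmP => i.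
rewrite mulmnE mnmE divnK // (dvdn_pcharf chp).
have [->|mi_gt0] := posnP (m i); first by rewrite eqxx.
(* This coefficient of the [i]-th derivative is [m i] times the nonzero coefficient of [P] at [m],
   so [m i] is zero in [K]. *)
have := congr1 (mcoeff (m - U_(i))) (dP0 i).
rewrite mcoeff_mderiv mcoeff0 submK; last first.
  by apply/mnm_lepP => l; rewrite mnm1E; case: eqP => // <-.
rewrite mnmBE mnm1E eqxx subn1 prednK // => h.
have /eqP := h; rewrite -[P@_m *+ _]mulr_natr mulf_eq0 orbC; case/orP => //.
by rewrite mcoeff_eq0 mP.
Qed.

(* Take a relation of least degree.  If all its partial derivatives vanish at u,
   they vanish identically, so it is a p-th power, K being perfect. *)
Lemma separating_relation (K : closedFieldType) N (O : idomainType)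
    (f : {rmorphism K -> O}) (u : 'I_N -> O) (P : {mpoly K[N]}) :
  P != 0 -> mmap f u P = 0 ->
  exists Q i, mmap f u Q = 0 /\ mmap f u Q^`M(i) != 0.
Proof.
have [k] := ubnP (msize P); elim: k P => // k IH P; rewrite ltnS => sP nzP fP.
have [[i nzi]|nex] := classic (exists i, mmap f u P^`M(i) != 0); first by exists P, i.
have fdP i : mmap f u P^`M(i) = 0.
  by apply/eqP/negPn/negP => nzi; apply: nex; exists i.
have [[i nzi]|nex'] := classic (exists i, P^`M(i) != 0).
  apply: (IH P^`M(i)) => //; apply: leq_trans sP.
  rewrite [msize P^`M(i)]mmeasureE.
  have P_gt0 : (0 < msize P)%N by rewrite lt0n msize_poly_eq0.
  rewrite -(prednK P_gt0) ltnS; apply/bigmax_leqP_seq => m mP _ /=.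
  rewrite -ltnS prednK //.
  have := @msize_mdeg_lt _ _ P (m + U_(i)).
  rewrite mdegD mdeg1 addn1; apply.
  move: mP; rewrite !mcoeff_msupp mcoeff_mderiv.
  by apply: contraNN => /eqP ->; rewrite mul0rn.
have dP0 i : P^`M(i) = 0 by apply/eqP/negPn/negP => nzi; apply: nex'; exists i.
(* [P] is not constant: a constant killed by the injective [f] would be zero. *)
have [m [mP nzm]] : exists m, m \in msupp P /\ m != 0%MM.
  apply: NNPP => nexm.
  have PC : P = (P@_0)%:MP.
    apply/mpolyP => m; rewrite mcoeffC.
    have [->|nzm] := eqVneq 0%MM m; first by rewrite mulr1.
    rewrite mulr0; apply/eqP; rewrite mcoeff_eq0; apply/negP => mP.
    by apply: nexm; exists m; rewrite eq_sym.
  move: fP nzP; rewrite PC mmapC => /eqP; rewrite fmorph_eq0 => /eqP ->.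
  by rewrite mpolyC0 eqxx.
have [i nzmi] : exists i, m i != 0%N.
  apply: NNPP => nexi; case/eqP: nzm; apply/mnmP => i; rewrite mnm0E.
  by apply/eqP/negPn/negP => nzi; apply: nexi; exists i.
have [p chp] : exists p, p \in [pchar K].
  apply: (@natf0_pchar K (m i)); first by rewrite lt0n.
  have := congr1 (mcoeff (m - U_(i))) (dP0 i).
  rewrite mcoeff_mderiv mcoeff0 submK; last first.
    by apply/mnm_lepP => l; rewrite mnm1E; case: eqP => // <-; rewrite lt0n.
  rewrite mnmBE mnm1E eqxx subn1 prednK ?lt0n // => h.
  have /eqP := h; rewrite -[P@_m *+ _]mulr_natr mulf_eq0 orbC; case/orP => //.
  by rewrite mcoeff_eq0 mP.
have [Q PQ] := mpoly_pth_root chp dP0.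
have p_gt1 := prime_gt1 (pcharf_prime chp).
have nzQ : Q != 0 by apply: contraNneq nzP => Q0; rewrite PQ Q0 expr0n eqn0Ngt (ltnW p_gt1) eqxx.
apply: (IH Q) => //; last first.
  by apply/eqP; move: fP; rewrite PQ rmorphXn /= => /eqP; rewrite expf_eq0 => /andP [].
apply: leq_trans sP.
(* [msize] is the degree plus one. The descent from [P = Q ^+ p] to [Q] is strict only because [Q]
   is not constant. *)
have sQ : (1 < msize Q)%N.
  rewrite ltnNge; apply/negP => /msize1_polyC QC.
  move: mP; rewrite PQ QC -rmorphXn /= msuppC; case: eqP => // _.
  by rewrite inE (negPf nzm).
rewrite PQ msize_exp //; move: sQ; case: (msize Q) => [|[|k']] //= _.
by rewrite ltnS ltn_Pmulr.
Qed.

(** * Derivations of fields of fractions *)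

Lemma mderivXU (R : nzRingType) N (i k : 'I_N) :
  'X_i^`M(k) = (i == k)%:R :> {mpoly R[N]}.
Proof.
rewrite mderivX mnm1E; case: eqP => [->|_]; last by rewrite scale0r.
rewrite scale1r -mpolyX0; congr 'X_[_].
by apply/mnmP => l; rewrite mnmBE subnn mnm0E.
Qed.

Fact quotient_rule_add (O : fieldType) (p q p' q' dp dq dp' dq' : O) :
  q != 0 -> q' != 0 ->
  ((dp * q' + p * dq' + (dp' * q + p' * dq)) * (q * q') -
   (p * q' + p' * q) * (dq * q' + q * dq')) / (q * q') ^+ 2 =
  (dp * q - p * dq) / q ^+ 2 + (dp' * q' - p' * dq') / q' ^+ 2.
Proof. by move=> nzq nzq'; field; rewrite nzq nzq'. Qed.

Fact quotient_rule_mul (O : fieldType) (p q p' q' dp dq dp' dq' : O) :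
  q != 0 -> q' != 0 ->
  ((dp * p' + p * dp') * (q * q') - p * p' * (dq * q' + q * dq')) / (q * q') ^+ 2 =
  p / q * ((dp' * q' - p' * dq') / q' ^+ 2) + p' / q' * ((dp * q - p * dq) / q ^+ 2).
Proof. by move=> nzq nzq'; field; rewrite nzq nzq'. Qed.

Section FractionDerivation.

Variables (R : idomainType) (N : nat).
Notation ratfun := {fraction {mpoly R[N]}}.
Implicit Types (p q : {mpoly R[N]}) (s t : ratfun).

(** The partial derivative, extended to fractions by the quotient rule on a chosen representative;
    [fderivE] shows that any other representative gives the same value. *)
Definition fderiv (k : 'I_N) s : ratfun :=
  let p := \n_(repr s) in let q := \d_(repr s) in
  (p^`M(k) * q - p * q^`M(k))%:F / q%:F ^+ 2.

Lemma frac_repr s : s = (\n_(repr s))%:F / (\d_(repr s))%:F.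
Proof.
rewrite -{1}[s]reprK -[_ / _]/(FracField.mul _ (FracField.inv _)).
rewrite !piE; apply/eqmodP; rewrite /= FracField.equivfE /=.
rewrite /FracField.mulf /FracField.invf !numden_Ratio ?oner_neq0 ?mul1r ?mulr1 ?denom_ratioP //.
by rewrite mulrC.
Qed.

Lemma fracP s : exists p q, q != 0 /\ s = p%:F / q%:F.
Proof. by exists \n_(repr s), \d_(repr s); rewrite denom_ratioP -frac_repr. Qed.

Lemma fderivE k p q : q != 0 ->
  fderiv k (p%:F / q%:F) = (p^`M(k) * q - p * q^`M(k))%:F / q%:F ^+ 2.
Proof.
move=> nzq; rewrite /fderiv; set s := p%:F / q%:F.
move: (frac_repr s) (denom_ratioP (repr s)).
move: \n_(repr s) \d_(repr s) => n d; rewrite {}/s => /eqP sE nzd.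
move: sE; rewrite eqr_div ?tofrac_eq0 // -!tofracM tofrac_eq => /eqP sE.
have := congr1 (mderiv k) sE; rewrite !mderivM => dsE.
rewrite -!tofracXn; apply/eqP; rewrite eqr_div ?tofrac_eq0 ?expf_neq0 // -!tofracM tofrac_eq.
rewrite -subr_eq0; apply/eqP.
(* The difference of the cross products is a combination of the relation [p * d = n * q] and of its
   derivative. *)
have -> : (n^`M(k) * d - n * d^`M(k)) * q ^+ 2 - (p^`M(k) * q - p * q^`M(k)) * d ^+ 2 =
  (q * d^`M(k) + d * q^`M(k)) * (p * d - n * q) -
  q * d * ((p^`M(k) * d + p * d^`M(k)) - (n^`M(k) * q + n * q^`M(k))) by ring.
by rewrite sE dsE !subrr !mulr0 subr0.
Qed.

Lemma fderiv_tofrac k p : fderiv k p%:F = (p^`M(k))%:F.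
Proof.
rewrite -[p%:F]divr1 -tofrac1 fderivE ?oner_neq0 //.
by rewrite -mpolyC1 mderivC mulr0 subr0 mpolyC1 mulr1 tofrac1 expr1n divr1.
Qed.

Lemma fderivD k : {morph fderiv k : s t / s + t}.
Proof.
move=> s t; have [p [q [nzq ->]]] := fracP s; have [p' [q' [nzq' ->]]] := fracP t.
have nzQ : q%:F != 0 by rewrite tofrac_eq0.
have nzQ' : q'%:F != 0 by rewrite tofrac_eq0.
have -> : p%:F / q%:F + p'%:F / q'%:F = (p * q' + p' * q)%:F / (q * q')%:F.
  by rewrite (addf_div _ _ nzQ nzQ') (tofracD (p * q')) !tofracM.
rewrite !fderivE ?mulf_neq0 //.
rewrite !(mderivM, mderivD, tofracM, tofracB, tofracD).
by rewrite -(quotient_rule_add _ _ _ _ _ _ nzQ nzQ').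
Qed.

Lemma fderivM k s t : fderiv k (s * t) = s * fderiv k t + t * fderiv k s.
Proof.
have [p [q [nzq ->]]] := fracP s; have [p' [q' [nzq' ->]]] := fracP t.
have nzQ : q%:F != 0 by rewrite tofrac_eq0.
have nzQ' : q'%:F != 0 by rewrite tofrac_eq0.
have -> : p%:F / q%:F * (p'%:F / q'%:F) = (p * p')%:F / (q * q')%:F.
  by rewrite mulf_div !tofracM.
rewrite !fderivE ?mulf_neq0 //.
rewrite !(mderivM, mderivD, tofracM, tofracB, tofracD).
by rewrite -(quotient_rule_mul _ _ _ _ _ _ nzQ nzQ').
Qed.

Lemma fderivC k (c : R) : fderiv k c%:MP%:F = 0.
Proof. by rewrite fderiv_tofrac mderivC tofrac0. Qed.

End FractionDerivation.

Section ConstantDerivation.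

Variables (K O : fieldType) (f : {rmorphism K -> O}) (D : O -> O).

Definition constant_derivation : Prop :=
  [/\ {morph D : s t / s + t},
      forall s t, D (s * t) = s * D t + t * D s & forall c, D (f c) = 0].

Hypothesis derD : constant_derivation.

Lemma derivation0 : D 0 = 0.
Proof. by case: derD => _ _ /(_ 0); rewrite rmorph0. Qed.

(** The chain rule, which turns a polynomial relation between the [u i] into a linear relation
    between their derivatives. *)
Lemma derivation_mmap N (u : 'I_N -> O) (P : {mpoly K[N]}) :
  D (mmap f u P) = \sum_i mmap f u P^`M(i) * D (u i).
Proof.
case: derD => DD DM DC; elim/mpoly_ring_ind: P => [c|i|p q IHp IHq|p q IHp IHq].
- rewrite mmapC DC big1 // => i _; by rewrite mderivC mmap0 mul0r.
- rewrite mmapX mmap1U (bigD1 i) //= big1 => [|l lNi].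
    by rewrite addr0 mderivXU eqxx rmorph1 mul1r.
  by rewrite mderivXU eq_sym (negPf lNi) mmap0 mul0r.
- rewrite mmapD DD IHp IHq -big_split /=; apply: eq_bigr => i _.
  by rewrite mderivD mmapD mulrDl.
- rewrite rmorphM DM IHp IHq !mulr_sumr -big_split /=; apply: eq_bigr => i _.
  by rewrite mderivM mmapD !rmorphM /=; ring.
Qed.

Lemma derivation_div0 s t : D s = 0 -> D t = 0 -> D (s / t) = 0.
Proof.
case: derD => _ DM _ Ds Dt.
have [->|nzt] := eqVneq t 0; first by rewrite invr0 mulr0 derivation0.
have : D (t * (s / t)) = 0 by rewrite mulrC divfK.
by rewrite DM Dt mulr0 addr0 => /eqP; rewrite mulf_eq0 (negPf nzt) => /eqP.
Qed.

Lemma derivation_horner (p : {poly O}) a :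
  (forall i, D p`_i = 0) -> D p.[a] = p^`().[a] * D a.
Proof.
case: derD => DD DM _; elim/poly_ind: p => [|p c IH] Dp.
  by rewrite deriv0 !horner0 derivation0 mul0r.
rewrite derivD derivM derivX derivC !hornerE DD DM.
have -> : D c = 0 by have := Dp 0%N; rewrite coefD coefMX coefC !add0r.
rewrite IH; first by ring.
by move=> i; have := Dp i.+1; rewrite coefD coefMX coefC addr0.
Qed.

End ConstantDerivation.

(** * The flat Jacobian in an affine chart *)

Section AugmentedJacobian.

Variables (R : comNzRingType) (n : nat) (F : 'I_n.+1 -> {mpoly R[n.+1]}).

(* Its determinant is x_i times the flat Jacobian, with no factor d. *)
Definition augmented_jacobian (i : 'I_n.+1) : 'M[{mpoly R[n.+1]}]_n.+1 :=
  \matrix_(l, k) if k == i then F l else (F l)^`M(k).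

(** Cramer's rule: Euler's identity says that the Jacobian matrix maps the column of variables to
    [d] times the column of forms. Multiplying by the adjugate and reading entry [i] gives the
    expansion of the augmented determinant along column [i]. *)
Lemma det_augmented_jacobian d i :
  (forall l, \sum_k (F l)^`M(k) * 'X_k = d%:R * F l) ->
  \det (\matrix_(l, k) (F l)^`M(k)) * 'X_i = d%:R * \det (augmented_jacobian i).
Proof.
move=> euler; set M := \matrix_(l, k) _.
have MX : M *m (\col_k 'X_k) = d%:R *: \col_l F l.
  apply/matrixP => l z; rewrite !mxE -euler.
  by apply: eq_bigr => k _; rewrite !mxE.
have /(congr1 (fun Z : 'cV_n.+1 => Z i 0)) :
    \det M *: \col_k 'X_k = d%:R *: (\adj M *m \col_l F l).
  by rewrite -mul_scalar_mx -mul_adj_mx -mulmxA MX scalemxAr.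
rewrite [LHS]mxE [RHS]mxE [(\col_k 'X_k) i 0]mxE => ->; congr (_ * _).
rewrite (expand_det_col _ i) mxE; apply: eq_bigr => l _.
rewrite !mxE eqxx mulrC; congr (_ * (_ * \det _)).
by apply/matrixP => a b; rewrite !mxE eq_sym (negPf (neq_lift _ _)).
Qed.

End AugmentedJacobian.

Fact mulf_cancel (R : idomainType) (c a b x y : R) :
  c != 0 -> c * a = b -> b * x = c * y -> a * x = y.
Proof. by move=> nzc <- E; apply: (mulfI nzc); rewrite mulrA. Qed.

Section Theta.

Variables (K : fieldType) (n d : nat) (F : (n.+1).-tuple {mpoly K[n.+1]}).

(** The universal form has all monomials of degree [d], and homogeneity excludes any other monomial
    from [tnth F i]. *)
Lemma theta_univ_form i : tnth F i \is d.-homog -> theta F (univ_form d i) = tnth F i.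
Proof.
move=> homF; rewrite /theta /univ_form rmorph_sum /=.
under eq_bigr => a _ do rewrite map_mpolyZ map_mpolyX /univ_coef /= mmapX mmap1U
  /specialize_coef enum_rankK.
apply/mpolyP => m; rewrite raddf_sum /=.
under eq_bigr => a _ do rewrite mcoeffZ mcoeffX.
have [md|mNd] := eqVneq (mdeg m) d; last first.
  rewrite (dhomog_nemf_coeff homF mNd) big1 // => a _.
  case: eqP => [am|_]; last by rewrite mulr0.
  by case/eqP: mNd; rewrite -am; apply/eqP/(valP a).
have m_lt : (mdeg m < d.+1)%N by rewrite md.
have m_d : mdeg (BMultinom m_lt) == d by rewrite /= md.
rewrite (bigD1 (Sub (BMultinom m_lt) m_d : mindex n d)) //= big1 => [|a aNm].
  by rewrite addr0 /mindex_mnm SubK /= eqxx mulr1.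
case: eqP => [am|_]; last by rewrite mulr0.
by case/eqP: aNm; do 2!apply: val_inj; rewrite SubK.
Qed.

Lemma flat_jacobianX i : (0 < d)%N -> (forall l, tnth F l \is d.-homog) ->
  flat_jacobian d F * 'X_i = \det (augmented_jacobian (tnth F) i).
Proof.
move=> d_gt0 homF.
pose th : {rmorphism {mpoly {mpoly int[nuniv n d]}[n.+1]} -> {mpoly K[n.+1]}} :=
  map_mpoly (mmap (intr : int -> K) (specialize_coef F)).
(* The factor [d] is cancelled over the integers, before specializing: its image in [K] may be
   zero. *)
have nzd : d%:R != 0 :> {mpoly {mpoly int[nuniv n d]}[n.+1]}.
  by rewrite -mpolyC_nat mpolyC_eq0 -mpolyC_nat mpolyC_eq0 Num.Theory.pnatr_eq0 -lt0n.
have univE : univ_flat_jacobian n d * 'X_i =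
    \det (augmented_jacobian (@univ_form n d) i).
  have detE : univ_jacobian n d * 'X_i = d%:R * \det (augmented_jacobian (@univ_form n d) i).
    rewrite /univ_jacobian /univ_jacobian_mx.
    exact: (det_augmented_jacobian i (@euler_univ_form n d)).
  exact (mulf_cancel nzd (univ_flat_jacobianE n d_gt0) detE).
have thX : th 'X_i = 'X_i by rewrite /= map_mpolyX.
rewrite -thX -[flat_jacobian d F]/(th _) -rmorphM univE -det_map_mx.
congr (\det _); apply/matrixP => l k; rewrite !mxE.
have thF : th (univ_form d l) = tnth F l by exact: theta_univ_form.
case: eqP => // _; rewrite -thF.
by apply/mpolyP => m; rewrite mcoeff_map_mpoly !mcoeff_mderiv mcoeff_map_mpoly /= mmapMn.
Qed.

End Theta.

(** Subtracting [w l] times row [j] from each other row [l] is left multiplication by the matrix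
    [L], of determinant 1. It leaves [M j i] as the only entry of column [i], along which the
    determinant is expanded. *)
Lemma det_column_proportional (R : comNzRingType) n (M : 'M[R]_n.+1) i j (w : 'I_n.+1 -> R) :
  (forall l, M l i = w l * M j i) ->
  \det M = (-1) ^+ (j + i) * M j i *
    \det (\matrix_(l, k) (M (lift j l) (lift i k) - w (lift j l) * M j (lift i k))).
Proof.
move=> Mi.
pose L := \matrix_(l, m) (if l == j then (m == j)%:R
                          else (l == m)%:R - (m == j)%:R * w l) : 'M[R]_n.+1.
have detL : \det L = 1.
  rewrite (expand_det_row _ j) (bigD1 j) //= big1 => [|m mNj]; last first.
    by rewrite mxE eqxx (negPf mNj) mul0r.
  rewrite addr0 mxE !eqxx mul1r /cofactor addnn -signr_odd odd_double mul1r.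
  rewrite -[RHS](det1 R n); congr (\det _); apply/matrixP => a b.
  rewrite !mxE ![_ == j]eq_sym !(negPf (neq_lift _ _)) mul0r subr0.
  by rewrite (inj_eq lift_inj).
have LM l k : (L *m M) l k = if l == j then M l k else M l k - w l * M j k.
  rewrite mxE; case: eqP => [->|/eqP lNj].
    rewrite (bigD1 j) //= big1 => [|m mNj]; first by rewrite mxE !eqxx mul1r addr0.
    by rewrite mxE eqxx (negPf mNj) mul0r.
  under eq_bigr => m _ do rewrite mxE (negPf lNj) mulrBl.
  rewrite sumrB (bigD1 l) //= big1 => [|m mNl]; last first.
    by rewrite eq_sym (negPf mNl) mul0r.
  rewrite eqxx mul1r addr0 (bigD1 j) //= big1 => [|m mNj]; last first.
    by rewrite (negPf mNj) !mul0r.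
  by rewrite eqxx mul1r addr0.
have -> : \det M = \det (L *m M) by rewrite det_mulmx detL mul1r.
rewrite (expand_det_col _ i) (bigD1 j) //=.
rewrite big1 => [|l lNj]; last first.
  by rewrite LM (negPf lNj) Mi subrr mul0r.
rewrite addr0 LM eqxx /cofactor mulrCA mulrA; congr (_ * _); congr (\det _).
by apply/matrixP => a b; rewrite [LHS]mxE [LHS]mxE LM [RHS]mxE eq_sym (negPf (neq_lift _ _)).
Qed.

Section LocalJacobian.

Variables (K : fieldType) (n : nat).
Notation poly := {mpoly K[n.+1]}.
Notation ratfun := {fraction {mpoly K[n.+1]}}.
Variables (d : nat) (F : (n.+1).-tuple poly).

(* The derivation d/d(x_k/x_i) of the function field, in homogeneous coordinates. *)
Definition chart_deriv (i : 'I_n.+1) (k : 'I_n) (s : ratfun) : ratfun :=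
  ('X_i)%:F * fderiv (lift i k) s.

Definition form_quotient (j l : 'I_n.+1) : ratfun := (tnth F l)%:F / (tnth F j)%:F.

Definition chart_jacobian (i j : 'I_n.+1) : 'M[ratfun]_n :=
  \matrix_(k, l) chart_deriv i k (form_quotient j (lift j l)).

(** By the Leibniz rule, the row operation leaves [tnth F j] times the derivatives of the quotients
    of forms. Both exponents are [n.+1]: scaling a matrix of size [n] accounts for [n] factors, and
    the last one is the pivot on the right and the factor ['X_i] of the augmented determinant on the
    left. *)
Lemma det_chart_jacobian i j :
  (0 < d)%N -> (forall l, tnth F l \is d.-homog) -> tnth F j != 0 ->
  ('X_i)%:F ^+ n.+1 * (flat_jacobian d F)%:F =
    (-1) ^+ (j + i) * (tnth F j)%:F ^+ n.+1 * \det (chart_jacobian i j).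
Proof.
move=> d_gt0 homF nzFj.
have form_neq0 : (tnth F j)%:F != 0 by rewrite tofrac_eq0.
pose M := map_mx (@tofrac _) (augmented_jacobian (tnth F) i).
have detM : \det M = ('X_i)%:F * (flat_jacobian d F)%:F.
  by rewrite det_map_mx -(flat_jacobianX i d_gt0 homF) rmorphM mulrC.
have Mi l : M l i = form_quotient j l * M j i.
  by rewrite !mxE eqxx divfK.
rewrite exprSr -mulrA -detM (det_column_proportional Mi).
have -> : M j i = (tnth F j)%:F by rewrite !mxE eqxx.
have -> : \matrix_(l, k) (M (lift j l) (lift i k) - form_quotient j (lift j l) * M j (lift i k)) =
   (tnth F j)%:F *: (\matrix_(k, l) fderiv (lift i k) (form_quotient j (lift j l)))^T.
  apply/matrixP => l k; rewrite !mxE eq_sym (negPf (neq_lift _ _)).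
  rewrite -!fderiv_tofrac -{1}[(tnth F (lift j l))%:F](divfK form_neq0) fderivM.
  by rewrite addrAC subrr add0r.
have -> : chart_jacobian i j =
   ('X_i)%:F *: \matrix_(k, l) fderiv (lift i k) (form_quotient j (lift j l)).
  by apply/matrixP => k l; rewrite !mxE.
rewrite !detZ det_tr exprSr; ring.
Qed.

End LocalJacobian.

(** * Local rings and tangent spaces *)

Fact mulf_div_sqr (O : fieldType) (x a : O) : x != 0 -> x * (a * x / x ^+ 2) = a.
Proof. by move=> nzx; field. Qed.

Section LocalRings.

Variables (K : closedFieldType) (n : nat).
Notation poly := {mpoly K[n.+1]}.
Notation ratfun := {fraction {mpoly K[n.+1]}}.
Notation coords := 'rV[K]_n.+1.
Implicit Types (g h : poly) (s t : ratfun) (x y : coords) (G : (n.+1).-tuple poly).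

Definition fconst : {rmorphism K -> ratfun} := @tofrac _ \o @mpolyC n.+1 K.

Definition affine_coord (j l : 'I_n.+1) : ratfun := ('X_l)%:F / ('X_j)%:F.

Lemma eval_neq0 g (v : 'I_n.+1 -> K) : g.@[v] != 0 -> g != 0.
Proof. by apply: contraNneq => ->; rewrite meval0. Qed.

(** Every monomial of [g] has degree [m], so each contributes the same denominator. This is the
    passage between fractions of forms and polynomials in quotients. *)
Lemma mmap_homog m g G q : g \is m.-homog -> q != 0 ->
  mmap fconst (fun l => (tnth G l)%:F / q%:F) g = (g \mPo G)%:F / q%:F ^+ m.
Proof.
move=> homg nzq; rewrite comp_mpolyEX rmorph_sum mulr_suml.
rewrite /mmap !big_seq; apply: eq_bigr => k kg.
rewrite /= -mul_mpolyC tofracM -mulrA; congr (_ * _).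
rewrite comp_mpolyX rmorph_prod /mmap1 -(dhomog_mf homg kg) /= mdegE.
rewrite -prodrXr -prodf_div; apply: eq_bigr => l _.
by rewrite expr_div_n rmorphXn.
Qed.

Lemma mpolyX_neq0 j : 'X_j != 0 :> poly.
Proof. by rewrite -msupp_eq0 msuppX. Qed.

Lemma mmap_coord m g j : g \is m.-homog ->
  mmap fconst (affine_coord j) g = g%:F / ('X_j)%:F ^+ m.
Proof.
move=> homg; rewrite -[in RHS](comp_mpoly_id g) -(mmap_homog _ homg (mpolyX_neq0 j)).
apply: eq_bigr => k _; congr (_ * _); apply: eq_bigr => l _; congr (_ ^+ _).
by rewrite tnth_mktuple.
Qed.

Lemma comp_homog e m G g : (forall l, tnth G l \is e.-homog) ->
  g \is m.-homog -> g \mPo G \is (e * m).-homog.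
Proof.
move=> homG homg; rewrite comp_mpolyEX big_seq; apply: rpred_sum => k kg.
apply: rpredZ; rewrite comp_mpolyX -(dhomog_mf homg kg) /= mdegE big_distrr /=.
elim/big_rec2: _ => [|l a b _ homb]; first exact: dhomog1.
by apply: dhomogM => //; apply: dhomogMn.
Qed.

Lemma comp_eval G g x : (g \mPo G).@[x 0] = g.@[map_point G x 0].
Proof. by rewrite comp_mpoly_meval; apply: meval_eq => l; rewrite mxE. Qed.

Lemma local_ring_const x c : local_ring x (fconst c).
Proof.
exists 0%N, c%:MP, 1; split; last by rewrite tofrac1 divr1.
- by rewrite -[c%:MP]mulr1 mul_mpolyC; apply: rpredZ; apply: dhomog1.
- exact: dhomog1.
- by rewrite meval1 oner_eq0.
Qed.

Lemma local_ringD x s t : local_ring x s -> local_ring x t -> local_ring x (s + t).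
Proof.
move=> [m [g [h [hg hh nzh ->]]]] [m' [g' [h' [hg' hh' nzh' ->]]]].
exists (m + m')%N, (g * h' + g' * h), (h * h'); split.
- by apply: rpredD; [|rewrite addnC]; apply: dhomogM.
- exact: dhomogM.
- by rewrite mevalM mulf_neq0.
- by rewrite addf_div ?tofrac_eq0 ?(eval_neq0 nzh) ?(eval_neq0 nzh') // tofracD !tofracM.
Qed.

Lemma local_ringM x s t : local_ring x s -> local_ring x t -> local_ring x (s * t).
Proof.
move=> [m [g [h [hg hh nzh ->]]]] [m' [g' [h' [hg' hh' nzh' ->]]]].
exists (m + m')%N, (g * g'), (h * h'); split; try exact: dhomogM.
- by rewrite mevalM mulf_neq0.
- by rewrite mulf_div !tofracM.
Qed.

Lemma local_ring0 x : local_ring x 0.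
Proof. by rewrite -(rmorph0 fconst); apply: local_ring_const. Qed.

Lemma local_ring1 x : local_ring x 1.
Proof. by rewrite -(rmorph1 fconst); apply: local_ring_const. Qed.

Lemma local_ring_sum x I (r : seq I) (P : pred I) E :
  (forall i, P i -> local_ring x (E i)) -> local_ring x (\sum_(i <- r | P i) E i).
Proof. by apply: big_ind; [exact: local_ring0 | exact: local_ringD]. Qed.

Lemma local_ring_coord x j l : x 0 j != 0 -> local_ring x (affine_coord j l).
Proof.
move=> xj; exists 1%N, 'X_l, 'X_j; split; rewrite ?mevalXU ?dhomogX /= ?mdeg1 //.

Qed.

Lemma homog_mderiv m g k : g \is m.-homog -> g^`M(k) \is m.-1.-homog.
Proof.
move=> homg; apply/dhomogP => a; rewrite mcoeff_msupp mcoeff_mderiv => nz.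
have : (a + U_(k))%MM \in msupp g.
  by rewrite mcoeff_msupp; apply: contraNneq nz => ->; rewrite mul0rn.
by move/(dhomog_mf homg) => <-; rewrite /= mdegD mdeg1 addn1.
Qed.

Lemma local_ring_chart_deriv x i k s : local_ring x s -> local_ring x (chart_deriv i k s).
Proof.
move=> [m [g [h [hg hh nzh ->]]]]; have nzh0 := eval_neq0 nzh.
(* The quotient rule lowers the degree of the numerator by one, and ['X_i] restores it. *)
exists (m + m)%N, ('X_i * (g^`M(lift i k) * h - g * h^`M(lift i k))), (h ^+ 2); split.
(* Degree 0 is apart, since the truncated predecessor no longer lowers the degree; there the
   derivatives vanish. *)
- case: m hg hh => [|m] hg hh.
    have const0 f : f \is 0.-homog -> f^`M(lift i k) = 0.
      move=> homf; apply/mpolyP => a; rewrite mcoeff_mderiv mcoeff0.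
      by rewrite (dhomog_nemf_coeff homf) ?mul0rn //= mdegD mdeg1 addn1.
    by rewrite !const0 // mul0r mulr0 subr0 mulr0 rpred0.
  rewrite -[(m.+1 + m.+1)%N]/(1 + (m + m.+1))%N; apply: dhomogM.
    by rewrite dhomogX /= mdeg1.
  apply: rpredB; first by apply: dhomogM => //; apply: (homog_mderiv _ hg).
  by rewrite addnC; apply: dhomogM => //; apply: (homog_mderiv _ hh).
- by rewrite expr2; apply: dhomogM.
- by rewrite mevalM mulf_neq0.
- by rewrite /chart_deriv fderivE // tofracM tofracXn mulrA.
Qed.

Lemma chart_derivD i k : {morph chart_deriv i k : s t / s + t : ratfun}.
Proof. by move=> s t; rewrite /chart_deriv fderivD mulrDr. Qed.

Lemma chart_derivM i k s t :
  chart_deriv i k (s * t) = s * chart_deriv i k t + t * chart_deriv i k s.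
Proof. by rewrite /chart_deriv fderivM mulrDr !(mulrCA ('X_i)%:F). Qed.

Lemma chart_derivC i k c : chart_deriv i k (fconst c) = 0.
Proof. by rewrite /chart_deriv fderivC mulr0. Qed.

Lemma chart_deriv_derivation i k : constant_derivation fconst (chart_deriv i k).
Proof. by split; [exact: chart_derivD | exact: chart_derivM | exact: chart_derivC]. Qed.

Lemma chart_deriv_coord i k l : chart_deriv i k (affine_coord i (lift i l)) = (k == l)%:R.
Proof.
have nzX : ('X_i)%:F != 0 :> ratfun by rewrite tofrac_eq0 mpolyX_neq0.
rewrite /chart_deriv /affine_coord fderivE ?mpolyX_neq0 // !mderivXU.
rewrite [i == _](negPf (neq_lift _ _)) mulr0 subr0 (inj_eq lift_inj) eq_sym.
rewrite tofracM (mulf_div_sqr _ nzX).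
by case: (k == l); rewrite ?tofrac1 ?tofrac0.
Qed.

End LocalRings.

Fact divf_cancel (O : fieldType) (a b c : O) : a != 0 -> a / b * (c / a) = c / b.
Proof. by move=> nza; rewrite mulrC mulrA divfK. Qed.

Fact mulf_div_inv (O : fieldType) (a b : O) : a != 0 -> b != 0 -> a / b * (b / a) = 1.
Proof. by move=> nza nzb; rewrite -(invf_div b) mulVf // mulf_neq0 ?invr_eq0. Qed.

(** * Derivations of the stalks along a comorphism *)

Section StalkDerivations.

Variables (K : closedFieldType) (n : nat).
Notation poly := {mpoly K[n.+1]}.
Notation ratfun := {fraction {mpoly K[n.+1]}}.
Notation coords := 'rV[K]_n.+1.

(* com : O_y -> O_x is a morphism of K-algebras with graph phi, and D ranges
   over the derivations O_y -> O_x along com. *)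
Variables (x y : coords) (phi : ratfun -> ratfun -> Prop) (com : ratfun -> ratfun).
Hypothesis phiE : forall s t, local_ring y s -> (phi s t <-> t = com s).
Hypothesis com_local : forall s, local_ring y s -> local_ring x (com s).
Hypothesis comD : forall s t, local_ring y s -> local_ring y t -> com (s + t) = com s + com t.
Hypothesis comM : forall s t, local_ring y s -> local_ring y t -> com (s * t) = com s * com t.
Hypothesis comC : forall c : K, com (fconst K n c) = fconst K n c.
Variable j : 'I_n.+1.
Hypothesis yj : y 0 j != 0.

Notation A := (local_ring y).
Notation B := (local_ring x).
Notation der := (derivation A B phi).

Lemma der_leibniz T s t : der T -> A s -> A t ->
  T (s * t) = com s * T t + com t * T s.
Proof. by case=> _ _ _ TM As At; apply: TM => //; apply/phiE. Qed.

Lemma der_const T c : der T -> T (fconst K n c) = 0.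
Proof.
move=> derT; have A1 := local_ring1 y.
have T1 : T 1 = 0.
  have := der_leibniz derT A1 A1; rewrite mulr1.
  have -> : com 1 = 1 by rewrite -(rmorph1 (fconst K n)) comC.
  by rewrite !mul1r => /eqP; rewrite -[X in X == _]addr0 (inj_eq (addrI _)) eq_sym => /eqP.
case: derT => _ _ TZ _; have := TZ c 1 A1.
by rewrite mulr1 T1 mulr0.
Qed.

Lemma local_ring_mmap (g : poly) : A (mmap (fconst K n) (affine_coord K j) g).
Proof.
elim/mpoly_ring_ind: g => [c|l|p q Ap Aq|p q Ap Aq].
- by rewrite mmapC; apply: local_ring_const.
- by rewrite mmapX mmap1U; apply: local_ring_coord.
- by rewrite mmapD; apply: local_ringD.
- by rewrite rmorphM; apply: local_ringM.
Qed.

(** The local ring is a localization of the polynomial ring in the affine coordinates. Agreement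
    passes from the coordinates to polynomials by induction, then to a fraction by applying the
    Leibniz rule to denominator times fraction. *)
Lemma der_ext T T' : der T -> der T' ->
  (forall l, T (affine_coord K j (lift j l)) = T' (affine_coord K j (lift j l))) ->
  forall s, A s -> T s = T' s.
Proof.
move=> derT derT' TT' s As.
have TTg g : T (mmap (fconst K n) (affine_coord K j) g) =
    T' (mmap (fconst K n) (affine_coord K j) g).
  elim/mpoly_ring_ind: g => [c|l|p q IHp IHq|p q IHp IHq].
  - by rewrite mmapC !der_const.
  - rewrite mmapX mmap1U; case: (unliftP j l) => [k|] -> //.
    rewrite /affine_coord divff ?tofrac_eq0 ?mpolyX_neq0 // -(rmorph1 (fconst K n)).
    by rewrite !der_const.
  - rewrite mmapD; have Ap := local_ring_mmap p; have Aq := local_ring_mmap q.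
    case: derT => _ TD _ _; case: derT' => _ TD' _ _.
    by rewrite TD // TD' // IHp IHq.
  - rewrite rmorphM; have Ap := local_ring_mmap p; have Aq := local_ring_mmap q.
    by rewrite /= (der_leibniz derT Ap Aq) (der_leibniz derT' Ap Aq) IHp IHq.
have [m [g [h [hg hh nzh sE]]]] := As.
have nzh0 : h%:F != 0 by rewrite tofrac_eq0 (eval_neq0 nzh).
have nzX : ('X_j)%:F ^+ m != 0 :> ratfun by apply: expf_neq0; rewrite tofrac_eq0 mpolyX_neq0.
set hz := mmap (fconst K n) (affine_coord K j) h.
have Ahz : A hz by apply: local_ring_mmap.
have hzE : hz = h%:F / ('X_j)%:F ^+ m by apply: mmap_coord.
have hzs : hz * s = mmap (fconst K n) (affine_coord K j) g.
  by rewrite hzE sE (divf_cancel _ _ nzh0) (mmap_coord _ hg).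
(* [hz] is invertible in the local ring at [y], and [com] is multiplicative with [com 1 = 1]. *)
have com_hz : com hz != 0.
  have Ahi : A (('X_j)%:F ^+ m / h%:F).
    exists m, ('X_j ^+ m), h; split; [|exact: hh|exact: nzh|by rewrite tofracXn].
    by rewrite -[X in X.-homog]mul1n; apply: dhomogMn; rewrite dhomogX /= mdeg1.
  have : com (hz * (('X_j)%:F ^+ m / h%:F)) = 1.
    by rewrite hzE (mulf_div_inv nzh0 nzX) -(rmorph1 (fconst K n)) comC.
  rewrite (comM Ahz Ahi) => E; apply: contraTneq (oner_neq0 ratfun) => h0.
  by rewrite -E h0 mul0r eqxx.
have := TTg g; rewrite -hzs (der_leibniz derT Ahz As) (der_leibniz derT' Ahz As) TTg.
by move/addIr/(mulfI com_hz).
Qed.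

Lemma der_comb (a : 'rV[ratfun]_n) E : (forall k, B (a 0 k)) -> (forall k, der (E k)) ->
  der (fun s => \sum_k a 0 k * E k s).
Proof.
move=> Ba derE; split=> [s As|s t As At|c s As|s t s' t' As At ss' tt'].
- apply: local_ring_sum => k _; apply: local_ringM => //.
  by case: (derE k) => EB _ _ _; apply: EB.
- rewrite -big_split; apply: eq_bigr => k _ /=; rewrite -mulrDr.
  by case: (derE k) => _ ED _ _; rewrite ED.
- rewrite mulr_sumr; apply: eq_bigr => k _.
  by case: (derE k) => _ _ EZ _; rewrite EZ // mulrCA.
- rewrite !mulr_sumr -big_split; apply: eq_bigr => k _ /=.
  by case: (derE k) => _ _ _ EM; rewrite (EM s t s' t') // mulrDr !(mulrCA (a 0 k)).
Qed.

(** The coordinate derivation on the chart of [y], followed by [com]; these form the dual basis to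
    the affine coordinates. *)
Definition stalk_deriv (k : 'I_n) s := com (chart_deriv j k s).

Lemma stalk_deriv_derivation k : der (stalk_deriv k).
Proof.
split=> [s As|s t As At|c s As|s t s' t' As At]; rewrite /stalk_deriv.
- exact/com_local/local_ring_chart_deriv.
- by rewrite chart_derivD comD //; apply: local_ring_chart_deriv.
- rewrite -[c%:MP%:F]/(fconst K n c) chart_derivM chart_derivC mulr0 addr0.
  by rewrite comM ?comC //; [apply: local_ring_const | apply: local_ring_chart_deriv].
- move/phiE => -> // /phiE -> //; rewrite chart_derivM.
  have As' := local_ring_chart_deriv j k As; have At' := local_ring_chart_deriv j k At.
  by rewrite (comD (local_ringM As At') (local_ringM At As')) (comM As At') (comM At As').
Qed.

Lemma stalk_deriv_coord k l : stalk_deriv k (affine_coord K j (lift j l)) = (k == l)%:R.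
Proof. by rewrite /stalk_deriv chart_deriv_coord -(rmorph_nat (fconst K n)) comC. Qed.

Lemma stalk_deriv_sum_coord (a : 'rV[ratfun]_n) l :
  \sum_k a 0 k * stalk_deriv k (affine_coord K j (lift j l)) = a 0 l.
Proof.
rewrite (bigD1 l) //= stalk_deriv_coord eqxx mulr1 big1 ?addr0 // => k kNl.
by rewrite stalk_deriv_coord (negPf kNl) mulr0.
Qed.

Lemma der_expand T s : der T -> A s ->
  T s = \sum_k T (affine_coord K j (lift j k)) * stalk_deriv k s.
Proof.
move=> derT; pose a := \row_k T (affine_coord K j (lift j k)).
have aE k : a 0 k = T (affine_coord K j (lift j k)) by rewrite mxE.
under eq_bigr => k _ do rewrite -aE; move: s.
apply: der_ext => //; last by move=> l; rewrite stalk_deriv_sum_coord aE.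
apply: der_comb => [k|k]; last exact: stalk_deriv_derivation.
by rewrite aE; case: derT => TB _ _ _; apply/TB/local_ring_coord.
Qed.

Lemma stalk_deriv_basis : derivation_basis A B phi stalk_deriv.
Proof.
split=> [|T derT]; first exact: stalk_deriv_derivation.
exists (\row_k T (affine_coord K j (lift j k))); split.
  split=> [k|s As]; first by rewrite mxE; case: derT => TB _ _ _; apply/TB/local_ring_coord.
  by rewrite (der_expand derT As); apply: eq_bigr => k _; rewrite mxE.
move=> b [Bb Tb]; apply/rowP => l; rewrite mxE Tb; last exact: local_ring_coord.
by rewrite stalk_deriv_sum_coord.
Qed.

End StalkDerivations.

Lemma tofrac_div_eq (R : idomainType) (a b a' b' : R) : b != 0 -> b' != 0 ->
  a%:F / b%:F = a'%:F / b'%:F <-> a * b' = a' * b.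
Proof.
rewrite -tofrac_eq0 => nzb; rewrite -tofrac_eq0 => nzb'.
split=> [/eqP|E]; last apply/eqP; rewrite (eqr_div _ _ nzb nzb').
  by rewrite -!tofracM tofrac_eq => /eqP.
by rewrite -!tofracM tofrac_eq E.
Qed.

(** * The comorphism of f and the matrix of its differential *)

Section Pullback.

Variables (K : closedFieldType) (n d : nat) (F : (n.+1).-tuple {mpoly K[n.+1]}).
Notation poly := {mpoly K[n.+1]}.
Notation ratfun := {fraction {mpoly K[n.+1]}}.
Notation coords := 'rV[K]_n.+1.
Implicit Types (g h : poly) (s t : ratfun) (x y : coords).

Hypothesis homF : forall l, tnth F l \is d.-homog.

Lemma comp_neq0 g : g \mPo F != 0 -> g != 0.
Proof. by apply: contraNneq => ->; rewrite comp_mpoly0. Qed.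

Lemma pullback_fun s t t' : pullback F s t -> pullback F s t' -> t = t'.
Proof.
move=> [m [g [h [_ _ nzh -> ->]]]] [m' [g' [h' [_ _ nzh' sE ->]]]].
have {}sE := proj1 (tofrac_div_eq _ _ (comp_neq0 nzh) (comp_neq0 nzh')) sE.
by apply/(tofrac_div_eq _ _ nzh nzh'); rewrite -!rmorphM sE.
Qed.

Lemma pullback_const c : pullback F (fconst K n c) (fconst K n c).
Proof.
exists 0%N, c%:MP, 1; rewrite comp_mpoly1 comp_mpolyC tofrac1 divr1.
split=> //; [|exact: dhomog1|exact: oner_neq0].
by rewrite dhomogE msuppC; case: eqP => //= _; rewrite mdeg0.
Qed.

Lemma pullbackD s t s' t' : pullback F s s' -> pullback F t t' ->
  pullback F (s + t) (s' + t').
Proof.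
move=> [m [g [h [hg hh nzh -> ->]]]] [m' [g' [h' [hg' hh' nzh' -> ->]]]].
have nzhF : (h \mPo F)%:F != 0 by rewrite tofrac_eq0.
have nzhF' : (h' \mPo F)%:F != 0 by rewrite tofrac_eq0.
have nzh0 : h%:F != 0 by rewrite tofrac_eq0 comp_neq0.
have nzh0' : h'%:F != 0 by rewrite tofrac_eq0 comp_neq0.
exists (m + m')%N, (g * h' + g' * h), (h * h'); split.
- by apply: rpredD; [|rewrite addnC]; apply: dhomogM.
- exact: dhomogM.
- by rewrite rmorphM mulf_neq0.
- by rewrite (addf_div _ _ nzh0 nzh0') tofracD !tofracM.
- by rewrite (addf_div _ _ nzhF nzhF') rmorphD !rmorphM /= tofracD !tofracM.
Qed.

Lemma pullbackM s t s' t' : pullback F s s' -> pullback F t t' ->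
  pullback F (s * t) (s' * t').
Proof.
move=> [m [g [h [hg hh nzh -> ->]]]] [m' [g' [h' [hg' hh' nzh' -> ->]]]].
exists (m + m')%N, (g * g'), (h * h'); split; try exact: dhomogM.
- by rewrite rmorphM mulf_neq0.
- by rewrite mulf_div !tofracM.
- by rewrite mulf_div !rmorphM.
Qed.

Lemma pullback_coord j l : tnth F j != 0 -> pullback F (affine_coord K j l) (form_quotient F j l).
Proof.
have compX k : 'X_k \mPo F = tnth F k by rewrite comp_mpolyXU -tnth_nth.
move=> nzFj; exists 1%N, 'X_l, 'X_j; rewrite !compX; split=> //.
- by rewrite dhomogX /= mdeg1.
- by rewrite dhomogX /= mdeg1.
Qed.

Lemma pullback_local x s : local_ring (map_point F x) s ->
  exists2 t, pullback F s t & local_ring x t.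
Proof.
move=> [m [g [h [hg hh nzh ->]]]].
have nzhF : (h \mPo F).@[x 0] != 0 by rewrite comp_eval.
exists ((g \mPo F)%:F / (h \mPo F)%:F).
  exists m, g, h; split => //; exact: eval_neq0 nzhF.
by exists (d * m)%N, (g \mPo F), (h \mPo F); split => //; apply: comp_homog.
Qed.

(** Hilbert's epsilon turns the graph [pullback F] into a function, specified wherever a pullback
    exists, in particular on the local ring at the image of a point. *)
Definition comorph s : ratfun := epsilon (inhabits 0) (pullback F s).

Lemma comorphP s t : pullback F s t -> pullback F s (comorph s).
Proof. by move=> st; apply: epsilon_spec; exists t. Qed.

Lemma comorphE s t : pullback F s t -> comorph s = t.
Proof. by move=> st; exact (pullback_fun (comorphP st) st). Qed.

Lemma comorph_pullback x s : local_ring (map_point F x) s -> pullback F s (comorph s).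
Proof. by case/pullback_local => t /comorphP. Qed.

Lemma comorph_graph x s t : local_ring (map_point F x) s ->
  pullback F s t <-> t = comorph s.
Proof.
by move=> /comorph_pullback sE; split=> [/comorphE | ->].
Qed.

Lemma comorph_local x s : local_ring (map_point F x) s -> local_ring x (comorph s).
Proof. by case/pullback_local => t /comorphE ->. Qed.

Lemma comorphD x s t : local_ring (map_point F x) s -> local_ring (map_point F x) t ->
  comorph (s + t) = comorph s + comorph t.
Proof. by move=> /comorph_pullback As /comorph_pullback At; apply/comorphE/pullbackD. Qed.

Lemma comorphM x s t : local_ring (map_point F x) s -> local_ring (map_point F x) t ->
  comorph (s * t) = comorph s * comorph t.
Proof. by move=> /comorph_pullback As /comorph_pullback At; apply/comorphE/pullbackM. Qed.

Lemma comorphC c : comorph (fconst K n c) = fconst K n c.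
Proof. exact/comorphE/pullback_const. Qed.

Lemma tangent_stalk x i : x 0 i != 0 -> tangent_basis x (@chart_deriv K n i).
Proof.
move=> xi; apply: (@stalk_deriv_basis K n x x eq id _ _ _ _ _ i) => // s t _.
by split=> ->.
Qed.

Section AtPoint.

Variables (x : coords) (i j : 'I_n.+1).
Hypotheses (xi : x 0 i != 0) (Fxj : (tnth F j).@[x 0] != 0).

Notation E0 := (stalk_deriv comorph j).

Fact map_point_neq0 : map_point F x 0 j != 0.
Proof. by rewrite mxE. Qed.

Lemma pullback_tangent_stalk : pullback_tangent_basis F x E0.
Proof.
apply: (stalk_deriv_basis _ _ _ _ _ map_point_neq0).
- exact: comorph_graph.
- exact: comorph_local.
- exact: comorphD.
- exact: comorphM.
- exact: comorphC.
Qed.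

(** A chart derivation composed with the comorphism is a derivation along it, so it is determined by
    its values on the affine coordinates of the target. These pull back to the quotients of
    forms. *)
Lemma differential_chart_jacobian :
  differential_matrix F x (@chart_deriv K n i) E0 (chart_jacobian F i j).
Proof.
have nzFj := eval_neq0 Fxj.
split=> [k l|k s t As st].
  rewrite mxE; apply: local_ring_chart_deriv.
  by exists d, (tnth F (lift j l)), (tnth F j).
rewrite -(comorphE st).
have der_T : derivation (local_ring (map_point F x)) (local_ring x) (pullback F)
    (fun s => chart_deriv i k (comorph s)).
  split=> [u Au|u v Au Av|c u Au|u v u' v' Au Av uu' vv'].
  - exact/local_ring_chart_deriv/comorph_local.
  - by rewrite (comorphD Au Av) chart_derivD.
  - rewrite -[c%:MP%:F]/(fconst K n c) (comorphM (local_ring_const _ _) Au) comorphC.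
    by rewrite chart_derivM chart_derivC mulr0 addr0.
  - by rewrite (comorphM Au Av) chart_derivM (comorphE uu') (comorphE vv').
rewrite (der_expand (@comorph_graph x) (@comorph_local x) (@comorphD x) (@comorphM x)
  comorphC map_point_neq0 der_T As).
by apply: eq_bigr => l _; rewrite mxE (comorphE (pullback_coord _ nzFj)).
Qed.

(** Change of bases: [A] factors through the chart Jacobian, with [P] expressing [D] in the chart
    derivations and [Q] expressing the standard basis [E0] in [E]. *)
Lemma det_differential_eq0 D E A :
  tangent_basis x D -> pullback_tangent_basis F x E -> differential_matrix F x D E A ->
  \det (chart_jacobian F i j) = 0 -> \det A = 0.
Proof.
move=> [derD _] [derE basisE] [BA DA] det0.
have [BJ DJ] := differential_chart_jacobian.
have [derE0 _] := pullback_tangent_stalk.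
pose P : 'M[ratfun]_n := \matrix_(k, k') D k (affine_coord K i (lift i k')).
have DP k t : local_ring x t -> D k t = \sum_k' P k k' * chart_deriv i k' t.
  move=> Bt; rewrite (@der_expand K n x x eq id _ _ _ _ _ i xi _ _ (derD k) Bt) //; last first.
    by move=> u v _; split=> ->.
  by apply: eq_bigr => k' _; rewrite mxE.
have QE0 l : exists q : 'rV[ratfun]_n, (forall k, local_ring x (q 0 k)) /\
    (forall s, local_ring (map_point F x) s -> E0 l s = \sum_k q 0 k * E k s).
  by have [q [qE _]] := basisE _ (derE0 l); exists q.
have [Q QE] := fin_all_exists QE0.
suff -> : A = P *m chart_jacobian F i j *m (\matrix_(l, k) Q l 0 k).
  by rewrite !det_mulmx det0 mulr0 mul0r.
(* Row [k] of each side gives the coordinates in the basis [E] of one and the same derivation, and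
   such coordinates are unique. *)
apply/row_matrixP => k.
have BAk l : local_ring x (row k A 0 l) by rewrite mxE.
have [a [_ a_uniq]] := basisE _ (der_comb BAk derE).
transitivity a; first by apply/esym/a_uniq.
apply: a_uniq; split=> [l|s As].
  rewrite !mxE; apply: local_ring_sum => l' _; apply: local_ringM; last first.
    by rewrite mxE; case: (QE l').
  rewrite mxE; apply: local_ring_sum => k' _; apply: local_ringM; last exact: BJ.
  rewrite mxE; case: (derD k) => DB _ _ _; apply/DB/local_ring_coord/xi.
have sE := comorph_pullback As.
under eq_bigr => l _ do rewrite mxE.
rewrite -(DA k s (comorph s)) // DP; last exact: comorph_local.
under eq_bigr => k' _ do rewrite (DJ k' s (comorph s)) // mulr_sumr.
rewrite exchange_big /=.
under [RHS]eq_bigr => l _ do rewrite mxE mxE mulr_suml.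
rewrite [RHS]exchange_big /=; apply: eq_bigr => l' _.
transitivity ((P *m chart_jacobian F i j) k l' * E0 l' s).
  by rewrite [in RHS]mxE mulr_suml; apply: eq_bigr => k' _; rewrite mulrA.
rewrite (proj2 (QE l') s As) mulr_sumr; apply: eq_bigr => l _.
by rewrite [(\matrix_(_, _) _) l' l]mxE mulrA.
Qed.

End AtPoint.

End Pullback.

(** * The critical scheme *)

Lemma det_chart_jacobian_eq0 (K : fieldType) n d (F : (n.+1).-tuple {mpoly K[n.+1]}) i j :
  (0 < d)%N -> (forall l, tnth F l \is d.-homog) -> tnth F j != 0 ->
  \det (chart_jacobian F i j) = 0 <-> flat_jacobian d F = 0.
Proof.
move=> d_gt0 homF nzFj; have E := det_chart_jacobian i d_gt0 homF nzFj.
have nzX : ('X_i)%:F ^+ n.+1 != 0 :> {fraction {mpoly K[n.+1]}}.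
  by apply: expf_neq0; rewrite tofrac_eq0 -msupp_eq0 msuppX.
have nzF : (-1) ^+ (j + i) * (tnth F j)%:F ^+ n.+1 != 0 :> {fraction {mpoly K[n.+1]}}.
  by apply: mulf_neq0; [rewrite signr_eq0 | apply: expf_neq0; rewrite tofrac_eq0].
split=> [det0|J0].
  move: E; rewrite det0 mulr0 => /eqP; rewrite mulf_eq0 (negPf nzX) /=.
  by rewrite tofrac_eq0 => /eqP.
move: E; rewrite J0 tofrac0 mulr0 => /esym/eqP.
by rewrite mulf_eq0 (negPf nzF) /= => /eqP.
Qed.

Lemma endomorphism_chart (K : closedFieldType) n d (F : (n.+1).-tuple {mpoly K[n.+1]})
    (x : 'rV[K]_n.+1) : is_endomorphism d F -> x != 0 ->
  exists i j, x 0 i != 0 /\ (tnth F j).@[x 0] != 0.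
Proof.
move=> [_ nocommon] nzx; have [j Fxj] := nocommon x nzx.
by case/rV0Pn: nzx => i xi; exists i, j.
Qed.

Lemma critical_schemeP (K : closedFieldType) n d (F : (n.+1).-tuple {mpoly K[n.+1]}) :
  (0 < d)%N -> is_endomorphism d F ->
  flat_jacobian d F = 0 <-> eq_subscheme (critical_scheme F) projective_space.
Proof.
move=> d_gt0 endF; have homF := proj1 endF; split=> [J0 U openU [x0 Ux0] s|crit].
  have U_chart x : U x -> exists i j, x 0 i != 0 /\ (tnth F j).@[x 0] != 0.
    have [S [_ US]] := openU.
    by move/US => [nzx _]; exact: (endomorphism_chart endF nzx).
  split=> [critU|-> x Ux].
    have [i [j [xi Fxj]]] := U_chart _ Ux0.
    have [D [E [A [tanD tanE diffA [a _ ->]]]]] := critU x0 Ux0.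
    rewrite (det_differential_eq0 homF xi Fxj tanD tanE diffA) ?mulr0 //.
    exact/(det_chart_jacobian_eq0 i d_gt0 homF (eval_neq0 Fxj)).
  have [i [j [xi Fxj]]] := U_chart _ Ux.
  exists (@chart_deriv K n i), (stalk_deriv (comorph F) j), (chart_jacobian F i j); split.
  - exact: tangent_stalk.
  - exact: (pullback_tangent_stalk homF Fxj).
  - exact: (differential_chart_jacobian homF i Fxj).
  - by exists 0; [exact: local_ring0 | rewrite mul0r].
pose e0 : 'rV[K]_n.+1 := delta_mx 0 0.
have nze0 : e0 != 0 by apply/rV0Pn; exists 0; rewrite mxE !eqxx oner_eq0.
have [i [j [ei Fej]]] := endomorphism_chart endF nze0.
(* On this open set, nonempty since it contains [e0], a single chart Jacobian represents the
   differential at all points. Its determinant is then a section of the critical ideal, hence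
   zero. *)
pose U (x : 'rV[K]_n.+1) := x != 0 /\ ('X_i * tnth F j).@[x 0] != 0.
have openU : zariski_open U.
  exists (eq ('X_i * tnth F j)); split=> [g <-|x].
    by exists (1 + d)%N; apply: dhomogM => //; rewrite dhomogX /= mdeg1.
  by split=> [[nzx nzg]|[nzx [g <- nzg]]]; split=> //; exists ('X_i * tnth F j).
have U0 : exists x, U x.
  by exists e0; split=> //; rewrite mevalM mevalXU mulf_neq0.
apply/(det_chart_jacobian_eq0 i d_gt0 homF (eval_neq0 Fej)).
apply/(crit U openU U0) => x [nzx]; rewrite mevalM mevalXU mulf_eq0 negb_or => /andP [xi Fxj].
exists (@chart_deriv K n i), (stalk_deriv (comorph F) j), (chart_jacobian F i j); split.
- exact: tangent_stalk.
- exact: (pullback_tangent_stalk homF Fxj).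
- exact: (differential_chart_jacobian homF i Fxj).
- by exists 1; [exact: local_ring1 | rewrite mul1r].
Qed.

(** * Separability *)

Section MinimalPolynomial.

Variables (O : fieldType) (k : O -> Prop).
Hypotheses (kD : forall s t, k s -> k t -> k (s + t))
  (kM : forall s t, k s -> k t -> k (s * t))
  (kV : forall s, k s -> k s^-1) (kN : forall s, k s -> k (- s))
  (k1 : k 1) (k0 : k 0).

Definition subfield_poly (p : {poly O}) : Prop := forall i, k p`_i.

Lemma subfield_polyD p q : subfield_poly p -> subfield_poly q -> subfield_poly (p + q).
Proof. by move=> kp kq i; rewrite coefD; apply: kD. Qed.

Lemma subfield_polyN p : subfield_poly p -> subfield_poly (- p).
Proof. by move=> kp i; rewrite coefN; apply: kN. Qed.

Lemma subfield_polyC c : k c -> subfield_poly c%:P.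
Proof. by move=> kc i; rewrite coefC; case: eqP. Qed.

Lemma subfield_polyX : subfield_poly 'X.
Proof. by move=> i; rewrite coefX; case: eqP. Qed.

Lemma subfield_sum I (r : seq I) (P : pred I) E :
  (forall i, P i -> k (E i)) -> k (\sum_(i <- r | P i) E i).
Proof. by apply: big_ind. Qed.

Lemma subfield_polyM p q : subfield_poly p -> subfield_poly q -> subfield_poly (p * q).
Proof. by move=> kp kq i; rewrite coefM; apply: subfield_sum => l _; apply: kM. Qed.

Lemma subfield_poly_deriv p : subfield_poly p -> subfield_poly p^`().
Proof.
move=> kp i; rewrite coef_deriv -mulr_natl; apply: kM => //.
by elim: (i.+1) => [|m IH]; rewrite // mulrS; apply: kD.
Qed.

(** Long division: cancelling leading terms uses only operations under which [k] is closed. *)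
Lemma subfield_poly_division p q : subfield_poly p -> subfield_poly q -> q != 0 ->
  exists s r, [/\ subfield_poly s, subfield_poly r, p = q * s + r & (size r < size q)%N].
Proof.
move=> kp kq nzq; have [N] := ubnP (size p); elim: N p kp => // N IH p kp; rewrite ltnS => sp.
have [pq|qp] := ltnP (size p) (size q).
  by exists 0, p; split; rewrite ?mulr0 ?add0r // => i; rewrite coef0.
have nzlq : lead_coef q != 0 by rewrite lead_coef_eq0.
have [p0|nzp] := eqVneq p 0.
  by move: qp; rewrite p0 size_poly0 leqn0 size_poly_eq0 (negPf nzq).
pose t := (lead_coef p / lead_coef q) *: 'X^(size p - size q).
have kt : subfield_poly t.
  move=> i; rewrite coefZ coefXn; apply: kM; last by case: eqP.
  by apply: kM; [apply: kp | apply/kV/kq].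
have [] := IH (p - q * t); first by apply/subfield_polyD/subfield_polyN/subfield_polyM.
  apply: leq_trans sp; rewrite ltnNge; apply/negP => sle.
  have nzc : lead_coef p / lead_coef q != 0 by rewrite mulf_neq0 ?invr_eq0 ?lead_coef_eq0.
  have sizet : size t = (size p - size q).+1 by rewrite size_scale // size_polyXn.
  have nzt : t != 0 by rewrite -size_poly_eq0 sizet.
  have sqt : size (q * t) = size p by rewrite size_mul // sizet addnS /= subnKC.
  have : (p - q * t)`_(size p).-1 != 0.
    have /eqP -> : size p == size (p - q * t).
      by rewrite eqn_leq sle (leq_trans (size_polyD _ _)) // size_polyN sqt maxnn.
    rewrite -/(lead_coef _) lead_coef_eq0; apply: contraTneq sle => ->.
    by rewrite size_poly0 leqn0 size_poly_eq0.
  rewrite coefB -{2}sqt -/(lead_coef (q * t)) lead_coefM lead_coefZ lead_coefXn.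
  by rewrite mulr1 mulrC divfK // subrr eqxx.
move=> s [r [ks kr E sr]]; exists (s + t), r; split=> //; first exact: subfield_polyD.
by rewrite mulrDr addrAC -E subrK.
Qed.

Lemma minimal_poly_exists a h : subfield_poly h -> h != 0 -> root h a ->
  exists p, [/\ p \is monic, subfield_poly p, root p a &
    forall q, q != 0 -> subfield_poly q -> root q a -> (size p <= size q)%N].
Proof.
have [N] := ubnP (size h); elim: N h => // N IH h; rewrite ltnS => sh kh nzh ah.
have [[q [nzq kq aq sq]]|nex] := classic (exists q,
    [/\ q != 0, subfield_poly q, root q a & (size q < size h)%N]).
  exact: (IH q (leq_trans sq sh)).
have nzl : (lead_coef h)^-1 != 0 by rewrite invr_eq0 lead_coef_eq0.
exists ((lead_coef h)^-1 *: h); split.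
- by rewrite monicE lead_coefZ mulVf ?lead_coef_eq0.
- by move=> i; rewrite coefZ; apply: kM; [apply/kV/kh | apply: kh].
- by rewrite rootZ.
- move=> q nzq kq aq; rewrite size_scale // leqNgt; apply/negP => sq.
  by apply: nex; exists q.
Qed.

(** The minimal polynomial [p] divides [h], so a zero of its derivative at [a] would be one of the
    derivative of [h]. Thus the derivative of [p] is a nonzero polynomial over [k] of smaller
    degree, to which the irreducible [p] is coprime. *)
Lemma separable_minimal_poly a h : subfield_poly h -> root h a -> h^`().[a] != 0 ->
  exists2 p, [/\ p \is monic, subfield_poly p, root p a &
    forall q, q != 0 -> subfield_poly q -> root q a -> (size p <= size q)%N]
  & separable_poly p.
Proof.
move=> kh ah dha.
have nzh : h != 0 by apply: contraNneq dha => ->; rewrite deriv0 horner0.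
have [p minp] := minimal_poly_exists kh nzh ah; exists p => //.
case: minp => monp kp ap minp; have nzp := monic_neq0 monp.
(* Irreducibility of [p], by Euclid's algorithm: a nonzero remainder is covered by induction, while
   a zero one factors [p], and minimality of [p] at the root [a] makes [q] constant. *)
have coprime_lt q : q != 0 -> subfield_poly q -> (size q < size p)%N -> coprimep p q.
  have [N] := ubnP (size q); elim: N q => // N IH q; rewrite ltnS => sN nzq kq sq.
  have [s [r [ks kr pE sr]]] := subfield_poly_division kp kq nzq.
  have [r0|nzr] := eqVneq r 0; last first.
    have : coprimep r (1 * r + q * s).
      by rewrite mul1r addrC -pE coprimep_sym; apply: IH (leq_trans sr sN) nzr kr (ltn_trans sr sq).
    rewrite coprimep_addl_mul coprimepMr => /andP [rq _].
    by rewrite pE coprimep_sym mulrC coprimep_addl_mul coprimep_sym.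
  have nzs : s != 0 by apply: contraNneq nzp => s0; rewrite pE s0 r0 mulr0 addr0.
  move: ap; rewrite pE r0 addr0 rootM => /orP [aq|as_].
    by have := minp q nzq kq aq; rewrite leqNgt sq.
  have ss := minp s nzs ks as_.
  have sizep : size p = (size q + size s).-1 by rewrite pE r0 addr0 size_mul.
  have q1 : size q = 1%N.
    apply/eqP; rewrite eqn_leq lt0n size_poly_eq0 nzq andbT.
    move: ss; rewrite sizep; case: (size q) => // c; rewrite addSn /= -{2}[size s]add0n leq_add2r.
    by rewrite leqn0 => /eqP ->.
  have [c nzc ->] := size_poly1P _ (introT eqP q1).
  by rewrite -[c%:P]mulr1 mul_polyC coprimepZr // coprimep1.
have [s [r [ks kr hE sr]]] := subfield_poly_division kh kp nzp.
have r0 : r = 0.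
  apply/eqP/negPn/negP => nzr; have := minp r nzr kr.
  rewrite leqNgt sr /root; move: ah; rewrite /root hE hornerD hornerM (eqP ap) mul0r add0r.
  by move=> -> /(_ isT).
have dpa : p^`().[a] != 0.
  apply: contraNneq dha => dp0; rewrite hE r0 addr0 derivM hornerD !hornerM dp0 (eqP ap).
  by rewrite !mul0r addr0.
rewrite separable_poly.unlock; apply: coprime_lt; last exact: lt_size_deriv.
- by apply: contraNneq dpa => ->; rewrite horner0.
- exact: subfield_poly_deriv.
Qed.

End MinimalPolynomial.

(** * Counting forms and algebraic dependence *)

(** The exponents are at most [D], and the total degree recovers the exponent of the first variable
    from the [n] others. *)
Lemma card_mindex_le n D : (#|{: mindex n D}| <= D.+1 ^ n)%N.
Proof.
pose f (a : mindex n D) := [ffun l : 'I_n => inord (mindex_mnm a (lift ord0 l)) : 'I_D.+1].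
have mdegE' (a : mindex n D) : mdeg (mindex_mnm a) = D := eqP (valP a).
have le_D (a : mindex n D) l : (mindex_mnm a l <= D)%N.
  by rewrite -[X in (_ <= X)%N](mdegE' a) mdegE (bigD1 l) //= leq_addr.
have <- : #|{ffun 'I_n -> 'I_D.+1}| = (D.+1 ^ n)%N by rewrite card_ffun !card_ord.
apply: (@leq_card _ _ f) => a b /ffunP ab.
have abl l : mindex_mnm a (lift ord0 l) = mindex_mnm b (lift ord0 l).
  by have /(congr1 val) := ab l; rewrite !ffunE /= !inordK // ltnS.
apply/val_inj/val_inj/mnmP => l; case: (unliftP ord0 l) => [k|] ->; first exact: abl.
have := etrans (mdegE' a) (esym (mdegE' b)); rewrite !mdegE !big_ord_recl /=.
by under eq_bigr => l' _ do rewrite abl; move/addIn.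
Qed.

Lemma homog_eq0 (K : fieldType) n D (p : {mpoly K[n.+1]}) : p \is D.-homog ->
  (forall a : mindex n D, p@_(mindex_mnm a) = 0) -> p = 0.
Proof.
move=> homp p0; apply/mpolyP => m; rewrite mcoeff0.
have [md|mNd] := eqVneq (mdeg m) D; last exact: dhomog_nemf_coeff homp mNd.
have m_lt : (mdeg m < D.+1)%N by rewrite md.
have m_D : mdeg (BMultinom m_lt) == D by rewrite /= md.
by have := p0 (Sub (BMultinom m_lt) m_D); rewrite /mindex_mnm SubK.
Qed.

(* Monomials of exponents < M in n + 1 quotients of forms of degree e become,
   after clearing denominators, forms of degree e(n+1)M in n + 1 variables:
   there are M^(n+1) of them in a space of dimension O(M^n). *)
Lemma algebraic_dependence (K : closedFieldType) n e
    (p : 'I_n.+1 -> {mpoly K[n.+1]}) (q : {mpoly K[n.+1]}) :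
  (forall r, p r \is e.-homog) -> q \is e.-homog -> q != 0 ->
  exists2 P : {mpoly K[n.+1]}, P != 0 &
    mmap (fconst K n) (fun r => (p r)%:F / q%:F) P = 0.
Proof.
move=> homp homq nzq.
(* With this [M], the bound [D.+1 ^ n] is at most [((e * n.+1).+1 * M) ^ n = M.-1 * M ^ n], which is
   less than [M ^ n.+1], the number of monomials in the box. *)
pose M := ((e * n.+1).+1 ^ n).+1; pose N := (n.+1 * M)%N; pose D := (e * N)%N.
pose box := {ffun 'I_n.+1 -> 'I_M}.
pose mon (al : box) : 'X_{1..n.+1} := [multinom nat_of_ord (al r) | r < n.+1].
have mon_inj : injective mon.
  move=> al be /mnmP E; apply/ffunP => r; apply/val_inj.
  by have := E r; rewrite !mnmE.
have mon_le al : (mdeg (mon al) <= N)%N.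
  rewrite mdegE -[X in (_ <= X * _)%N]card_ord -sum_nat_const; apply: leq_sum => r _.
  by rewrite mnmE ltnW.
pose f (al : box) := q ^+ (N - mdeg (mon al)) * \prod_r p r ^+ mon al r.
have homf al : f al \is D.-homog.
  rewrite /D -[N in (_ * N)%N](subnK (mon_le al)) mulnDr.
  apply: dhomogM; first exact: dhomogMn.
  rewrite mdegE big_distrr /=.
  elim/big_rec2: _ => [|r a b _ homb]; first exact: dhomog1.
  by apply: dhomogM => //; apply: dhomogMn.
pose X : 'M[K]_(#|box|, #|{: mindex n D}|) :=
  \matrix_(a, b) (f (enum_val a))@_(mindex_mnm (enum_val b)).
have leq_exp_base a b c : (a <= b)%N -> (a ^ c <= b ^ c)%N.
  by move=> ab; case: c => // c; rewrite leq_exp2r.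
have card_lt : (#|{: mindex n D}| < #|box|)%N.
  apply: leq_ltn_trans (card_mindex_le n D) _.
  rewrite card_ffun !card_ord expnS.
  apply: (@leq_ltn_trans (((e * n.+1).+1 * M) ^ n)).
    by apply: leq_exp_base; rewrite mulSn -add1n /D /N mulnA leq_add2r.
  by rewrite expnMn ltn_mul2r expn_gt0 /= ltnSn.
have nzker : kermx X != 0.
  rewrite -mxrank_eq0 mxrank_ker -lt0n subn_gt0.
  exact: leq_ltn_trans (rank_leq_col X) card_lt.
(* A vector of the left kernel is a linear relation between the forms [f al], and its entries are
   the coefficients of [P]. *)
have /rowV0Pn [v vker nzv] := nzker.
have vX : v *m X = 0 by apply/sub_kermxP.
exists (\sum_a v 0 a *: 'X_[mon (enum_val a)]).
  have /rV0Pn [a va] := nzv.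
  apply: contraNneq va => /(congr1 (mcoeff (mon (enum_val a)))).
  rewrite mcoeff0 raddf_sum /= (bigD1 a) //= big1 => [|b bNa].
    by rewrite mcoeffZ mcoeffX eqxx mulr1 addr0 => ->.
  rewrite mcoeffZ mcoeffX (inj_eq mon_inj) (inj_eq enum_val_inj) (negPf bNa).
  by rewrite mulr0.
have nzqF : q%:F != 0 by rewrite tofrac_eq0.
have sum0 : \sum_a v 0 a *: f (enum_val a) = 0.
  apply: (@homog_eq0 _ _ D) => [|b].
    by apply: rpred_sum => a _; apply/rpredZ/homf.
  have := congr1 (fun Z : 'rV_#|{: mindex n D}| => Z 0 (enum_rank b)) vX.
  rewrite !mxE raddf_sum /= => E; rewrite -[RHS]E; apply: eq_bigr => a _.
  by rewrite mcoeffZ mxE enum_rankK.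
apply: (mulfI (expf_neq0 N nzqF)); rewrite mulr0.
transitivity (\sum_a v 0 a *: f (enum_val a))%:F; last by rewrite sum0 tofrac0.
rewrite !raddf_sum mulr_sumr.
apply: eq_bigr => a _.
rewrite /= mmapZ mmapX -mul_mpolyC tofracM mulrCA; congr (_ * _).
rewrite /mmap1 /f tofracM tofracXn rmorph_prod /=.
rewrite -[N in LHS](subnK (mon_le (enum_val a))) exprD -mulrA; congr (_ * _).
rewrite mdegE -prodrXr -big_split; apply: eq_bigr => r _ /=.
by rewrite -exprMn mulrC divfK // tofracXn.
Qed.

Fact divf_div_cancel (O : fieldType) (a b q : O) : q != 0 -> a / q / (b / q) = a / b.
Proof. by move=> nzq; rewrite invf_div mulrA divfK. Qed.

Section Specialization.

Variables (K O : fieldType) (c : {rmorphism K -> O}) (n : nat) (w : 'I_n -> O).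

(** Variable [ord0] stays free, to receive the element whose separability is tested; the others are
    set to [w], so the coefficients lie in the subfield generated by [w] over the constants. *)
Definition specialize_w : {mpoly K[n.+1]} -> {poly O} :=
  mmap (polyC \o c) (fun r => if unlift ord0 r is Some l then (w l)%:P else 'X).

Lemma horner_specialize_w a Q :
  (specialize_w Q).[a] = mmap c (fun r => if unlift ord0 r is Some l then w l else a) Q.
Proof.
rewrite /specialize_w; elim/mpoly_ring_ind: Q => [z|r|p q IHp IHq|p q IHp IHq].
- by rewrite !mmapC /= hornerC.
- by rewrite !mmapX !mmap1U; case: unliftP => [k|] _; rewrite ?hornerC ?hornerX.
- by rewrite !mmapD hornerD IHp IHq.
- by rewrite !rmorphM /= hornerM IHp IHq.
Qed.

Lemma deriv_specialize_w Q : (specialize_w Q)^`() = specialize_w Q^`M(ord0).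
Proof.
rewrite /specialize_w; elim/mpoly_ring_ind: Q => [z|r|p q IHp IHq|p q IHp IHq].
- by rewrite mderivC mmap0 mmapC /= derivC.
- rewrite mmapX mmap1U mderivXU; case: (unliftP ord0 r) => [k|] ->.
    by rewrite derivC [lift _ _ == _]eq_sym (negPf (neq_lift _ _)) mmap0.
  by rewrite derivX eqxx rmorph1.
- by rewrite mderivD !mmapD derivD IHp IHq.
- by rewrite mderivM mmapD !rmorphM /= derivM IHp IHq.
Qed.

Lemma coefs_specialize_w (k : O -> Prop) Q :
  (forall s t, k s -> k t -> k (s + t)) -> (forall s t, k s -> k t -> k (s * t)) ->
  (forall z, k (c z)) -> (forall l, k (w l)) -> subfield_poly k (specialize_w Q).
Proof.
move=> kD kM kC kw.
have k0 : k 0 by rewrite -(rmorph0 c).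
have k1 : k 1 by rewrite -(rmorph1 c).
rewrite /specialize_w; elim/mpoly_ring_ind: Q => [z|r|p q IHp IHq|p q IHp IHq].
- by rewrite mmapC; apply: subfield_polyC => //; exact: kC.
- rewrite mmapX mmap1U; case: unliftP => [l|] _; last exact: subfield_polyX.
  exact: subfield_polyC.
- by rewrite mmapD; apply: subfield_polyD.
- by rewrite rmorphM; apply: subfield_polyM.
Qed.

End Specialization.

(** * Separability and dominance of f *)

Section Separability.

Variables (K : closedFieldType) (n d : nat) (F : (n.+1).-tuple {mpoly K[n.+1]}).
Notation poly := {mpoly K[n.+1]}.
Notation ratfun := {fraction {mpoly K[n.+1]}}.
Implicit Types (g h : poly) (s t a : ratfun).

Hypothesis d_gt0 : (0 < d)%N.
Hypothesis homF : forall l, tnth F l \is d.-homog.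
Variable j : 'I_n.+1.
Hypothesis nzFj : tnth F j != 0.

Notation c := (fconst K n).
Notation w := (fun l : 'I_n => form_quotient F j (lift j l)).

Fact form_neq0 : (tnth F j)%:F != 0.
Proof. by rewrite tofrac_eq0. Qed.

Lemma form_quotient_diag : form_quotient F j j = 1.
Proof. by rewrite /form_quotient divff // form_neq0. Qed.

Lemma coord_diag : affine_coord K j j = 1 :> ratfun.
Proof. by rewrite /affine_coord divff // tofrac_eq0 mpolyX_neq0. Qed.

(** The pulled back field is generated over [K] by the [w l]: dividing numerator and denominator by
    the same power of [tnth F j] makes both polynomials in the quotients of forms. *)
Lemma pullback_derivation0 D s t : constant_derivation c D ->
  (forall l, D (w l) = 0) -> pullback F s t -> D t = 0.
Proof.
move=> derD Dw [m [g [h [hg hh nzh _ ->]]]].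
have Dfform l : D (form_quotient F j l) = 0.
  case: (unliftP j l) => [k|] ->; first exact: Dw.
  by rewrite form_quotient_diag -(rmorph1 c); case: derD.
have Dmmap f : D (mmap c (form_quotient F j) f) = 0.
  by rewrite (derivation_mmap derD) big1 // => l _; rewrite Dfform mulr0.
have -> : (g \mPo F)%:F / (h \mPo F)%:F =
    mmap c (form_quotient F j) g / mmap c (form_quotient F j) h.
  rewrite (mmap_homog _ hg nzFj) (mmap_homog _ hh nzFj).
  by rewrite (divf_div_cancel _ _ (expf_neq0 m form_neq0)).
by apply: (derivation_div0 derD).
Qed.

Lemma function_field_coord (i l : 'I_n.+1) : function_field (affine_coord K i l).
Proof.
by exists 1%N, 'X_l, 'X_i; split; rewrite ?mpolyX_neq0 ?dhomogX /= ?mdeg1.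
Qed.

Lemma flat_jacobian0_inseparable : flat_jacobian d F = 0 -> inseparable_map F.
Proof.
move=> J0 [_ sep]; pose i : 'I_n.+1 := ord0.
have /eqP/det0P [e nze eA] := proj2 (det_chart_jacobian_eq0 i d_gt0 homF nzFj) J0.
pose D s := \sum_k e 0 k * chart_deriv i k s.
have derD : constant_derivation c D.
  split=> [s t|s t|z]; rewrite /D.
  - by rewrite -big_split; apply: eq_bigr => k _; rewrite chart_derivD mulrDr.
  - rewrite !mulr_sumr -big_split; apply: eq_bigr => k _ /=.
    by rewrite chart_derivM mulrDr !(mulrCA (e 0 k)).
  - by rewrite big1 // => k _; rewrite chart_derivC mulr0.
have Dw l : D (w l) = 0.
  have := congr1 (fun Z : 'rV_n => Z 0 l) eA; rewrite !mxE => E.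
  by rewrite -[RHS]E; apply: eq_bigr => k _; rewrite mxE.
have /rV0Pn [k ek] := nze.
have Da : D (affine_coord K i (lift i k)) = e 0 k.
  rewrite /D (bigD1 k) //= chart_deriv_coord eqxx mulr1 big1 ?addr0 // => l lNk.
  by rewrite chart_deriv_coord (negPf lNk) mulr0.
have [p [_ coefp rootp _]] := sep _ (function_field_coord i (lift i k)).
(* Separability makes the derivative of [p] nonzero at the coordinate, whereas applying [D] to the
   equation given by [p] makes its product with the nonzero [e 0 k] vanish. *)
rewrite separable_poly.unlock => /coprimep_root/(_ rootp) dp.
have := derivation_horner derD (affine_coord K i (lift i k)) (p := p).
rewrite (eqP rootp) (derivation0 derD) Da => H.
have : p^`().[affine_coord K i (lift i k)] * e 0 k = 0.
  by rewrite -H // => m; have [s st] := coefp m; apply: pullback_derivation0 derD Dw st.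
by move/eqP; rewrite mulf_eq0 (negPf dp) (negPf ek).
Qed.

Hypothesis J_neq0 : flat_jacobian d F != 0.

Lemma chart_jacobian_ker (v : 'I_n -> ratfun) :
  (forall k, \sum_l v l * chart_deriv ord0 k (w l) = 0) -> forall l, v l = 0.
Proof.
move=> v0 l.
have Aunit : chart_jacobian F ord0 j \in unitmx.
  rewrite unitmxE unitfE; apply: contraNneq J_neq0 => det0; apply/eqP.
  exact/(det_chart_jacobian_eq0 ord0 d_gt0 homF nzFj).
have Av : chart_jacobian F ord0 j *m (\col_l v l) = 0.
  apply/matrixP => k z; rewrite !mxE -[RHS](v0 k); apply: eq_bigr => m _.
  by rewrite !mxE mulrC.
have : \col_l v l = 0 by rewrite -[LHS](mulKmx Aunit) Av mulmx0.
by move/(congr1 (fun Z : 'cV_n => Z l 0)); rewrite !mxE.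
Qed.

(** The partial derivatives of a separating relation form a vector in the kernel of the invertible
    chart Jacobian, so all of them vanish at [w]. *)
Lemma form_quotient_algebraically_independent (P : {mpoly K[n]}) : mmap c w P = 0 -> P = 0.
Proof.
move=> P0; apply/eqP/negPn/negP => nzP.
have [Q [l [Q0 /eqP dQ]]] := separating_relation nzP P0; apply: dQ.
apply: (@chart_jacobian_ker (fun l => mmap c w Q^`M(l))) => k.
rewrite -(derivation_mmap (chart_deriv_derivation K ord0 k)) Q0.
exact: (derivation0 (chart_deriv_derivation K ord0 k)).
Qed.

Definition dehomog : poly -> {mpoly K[n]} :=
  mmap (@mpolyC n K) (fun l => if unlift j l is Some k then 'X_k else 1).

Lemma mmap_dehomog (v : 'I_n.+1 -> ratfun) g : v j = 1 ->
  mmap c (fun l => v (lift j l)) (dehomog g) = mmap c v g.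
Proof.
move=> vj; rewrite /dehomog; elim/mpoly_ring_ind: g => [z|l|p q IHp IHq|p q IHp IHq].
- by rewrite !mmapC.
- rewrite !mmapX !mmap1U; case: unliftP => [k|] ->; last by rewrite rmorph1.
  by rewrite mmapX mmap1U.
- by rewrite !mmapD IHp IHq.
- by rewrite !rmorphM /= IHp IHq.
Qed.

(** No hypersurface contains the image of f: setting the [j]-th variable to 1 would turn its
    equation into a relation between the [w l]. *)
Lemma comp_inj m g : g \is m.-homog -> g \mPo F = 0 -> g = 0.
Proof.
move=> homg gF0.
have dg0 : dehomog g = 0.
  apply: form_quotient_algebraically_independent.
  rewrite (mmap_dehomog _ form_quotient_diag) (mmap_homog _ homg nzFj) gF0.
  by rewrite tofrac0 mul0r.
have : g%:F / ('X_j)%:F ^+ m = 0 :> ratfun.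
  by rewrite -(mmap_coord _ homg) -(mmap_dehomog _ coord_diag) dg0 mmap0.
move/eqP; rewrite mulf_eq0 invr_eq0 expf_eq0 !tofrac_eq0 (negPf (mpolyX_neq0 _ _)).
by rewrite andbF orbF => /eqP.
Qed.

Lemma endomorphism_dominant : (forall x, x != 0 -> map_point F x != 0) -> dominant F.
Proof.
move=> nzF U [S [homS US]] [y /US [_ [g Sg nzgy]]].
have [m homg] := homS g Sg.
(* The factor ['X_ord0] ensures that the vector found is nonzero, hence a point of projective
   space. *)
have nzgF : 'X_ord0 * (g \mPo F) != 0.
  rewrite mulf_neq0 ?mpolyX_neq0 //; apply: contraNneq nzgy => /(comp_inj homg) ->.
  by rewrite meval0.
have [v nzv] : exists v, ('X_ord0 * (g \mPo F)).@[v] != 0.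
  apply: NNPP => nex; case/eqP: nzgF; apply: mpoly_eq0_eval => v.
  by apply/eqP/negPn/negP => nzv; apply: nex; exists v.
pose x := \row_l v l.
have vE h : h.@[v] = h.@[x 0] by apply: meval_eq => l; rewrite mxE.
move: nzv; rewrite vE mevalM mevalXU mulf_eq0 negb_or comp_eval => /andP [x0 gFx].
have nzx : x != 0 by apply/rV0Pn; exists ord0.
by exists x => //; apply/US; split; [exact: nzF | exists g].
Qed.

Notation kF := (fun t => exists s, pullback F s t).

Lemma pullback_field_inv t : kF t -> kF t^-1.
Proof.
move=> [s [m [g [h [hg hh nzh sE tE]]]]].
(* If the numerator pulls back to 0, the inverted fraction is not admissible; but then [t] is 0,
   which is its own inverse by convention. *)
have [g0|nzg] := eqVneq (g \mPo F) 0.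
  have -> : t^-1 = t by rewrite tE g0 tofrac0 mul0r invr0.
  by exists s, m, g, h.
exists (h%:F / g%:F), m, h, g; split=> //.
by rewrite tE invf_div.
Qed.

Lemma pullback_fieldD s t : kF s -> kF t -> kF (s + t).
Proof. by move=> [s' ss'] [t' tt']; exists (s' + t'); apply: pullbackD. Qed.

Lemma pullback_fieldM s t : kF s -> kF t -> kF (s * t).
Proof. by move=> [s' ss'] [t' tt']; exists (s' * t'); apply: pullbackM. Qed.

Lemma pullback_fieldC z : kF (c z).
Proof. by exists (c z); apply: pullback_const. Qed.

Section Generator.

Variable a : ratfun.
Notation u := (fun r : 'I_n.+1 => if unlift ord0 r is Some l then w l else a).

Lemma separating_generator : function_field a ->
  exists h : {poly ratfun}, [/\ subfield_poly kF h, root h a & h^`().[a] != 0].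
Proof.
move=> [m [g [h [hg hh nzh aE]]]].
(* Numerators of [a] and of the [w l] over the common denominator [tnth F j * h], of degree
   [d + m]. *)
pose p (r : 'I_n.+1) := if unlift ord0 r is Some l then tnth F (lift j l) * h else tnth F j * g.
have homp r : p r \is (d + m).-homog.
  by rewrite /p; case: unliftP => [l|] _; apply: dhomogM.
have [P nzP P0] : exists2 P : poly, P != 0 & mmap c u P = 0.
  have [P nzP P0] := algebraic_dependence homp (dhomogM (homF j) hh) (mulf_neq0 nzFj nzh).
  exists P => //; rewrite -[RHS]P0; apply: eq_bigr => al _; congr (_ * _).
  apply: mmap1_eq => r; rewrite /p /form_quotient aE; have nzhF : h%:F != 0 by rewrite tofrac_eq0.
  case: unliftP => [l|] _; rewrite !tofracM.
    by rewrite -mulf_div (divff nzhF) mulr1.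
  by rewrite -mulf_div (divff form_neq0) mul1r.
have [Q [r [Q0 dQ]]] := separating_relation nzP P0.
exists (specialize_w c w Q); split.
- apply: coefs_specialize_w.
  + exact: pullback_fieldD.
  + exact: pullback_fieldM.
  + exact: pullback_fieldC.
  + by move=> l; exists (affine_coord K j (lift j l)); apply: pullback_coord.
-
 by rewrite /root horner_specialize_w Q0.
(* If the derivative in variable [ord0] vanished at [u], the other partial derivatives would form a
   kernel vector of the chart Jacobian and vanish too, against the choice of [Q]. *)
rewrite deriv_specialize_w horner_specialize_w; apply/negP => /eqP dQ0.
have dQw : forall l, mmap c u Q^`M(lift ord0 l) = 0.
  apply: chart_jacobian_ker => k.
  have derD := chart_deriv_derivation K (ord0 : 'I_n.+1) k.
  have := derivation_mmap derD u Q; rewrite Q0 (derivation0 derD) big_ord_recl dQ0 mul0r add0r.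
  by move=> E; rewrite [RHS]E; apply: eq_bigr => l _; rewrite liftK.
case/eqP: dQ; case: (unliftP ord0 r) => [l|] ->; first exact: dQw.
exact: dQ0.
Qed.

End Generator.

Lemma flat_jacobian_neq0_separable :
  separable_extension (fun t => exists s, pullback F s t) (@function_field K n).
Proof.
move=> a /separating_generator [h [kh ah dha]].
have k0 : kF 0 by rewrite -(rmorph0 c); apply: pullback_fieldC.
have k1 : kF 1 by rewrite -(rmorph1 c); apply: pullback_fieldC.
have kN s : kF s -> kF (- s).
  move=> ks; rewrite -mulN1r -(rmorph1 c) -rmorphN.
  by apply: pullback_fieldM ks; apply: pullback_fieldC.
have [p [p1 p2 p3 p4] sepp] :=
  separable_minimal_poly pullback_fieldD pullback_fieldM pullback_field_inv kN k1 k0 kh ah dha.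
by exists p; [exact (And4 p1 p2 p3 p4) | exact sepp].
Qed.

End Separability.

Theorem corollary1p4 (K : closedFieldType) (n d : nat)
    (hn : (1 <= n)%N) (hd : (1 <= d)%N)
    (F : (n.+1).-tuple {mpoly K[n.+1]}) (hF : is_endomorphism d F) :
  (inseparable_map F <-> flat_jacobian d F = 0) /\
  (flat_jacobian d F = 0 <-> eq_subscheme (critical_scheme F) projective_space).
Proof.
split; last exact: critical_schemeP.
have [homF nocommon] := hF.
pose e0 : 'rV[K]_n.+1 := delta_mx 0 0.
have nze0 : e0 != 0 by apply/rV0Pn; exists 0; rewrite mxE !eqxx oner_eq0.
have [j Fej] := nocommon e0 nze0; have nzFj := eval_neq0 Fej.
split=> [insep|J0]; last exact: (flat_jacobian0_inseparable hd homF nzFj J0).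
apply/eqP/negPn/negP => nzJ; apply: insep; split.
  apply: (endomorphism_dominant hd homF nzFj nzJ) => x /nocommon [l Fxl].
  by apply/rV0Pn; exists l; rewrite mxE.
exact: (flat_jacobian_neq0_separable hd homF nzFj nzJ).
Qed.
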